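(* Let $R$ be a ring, $M$ a (right $R$-) module, and $\mathcal Q$ a class of left $R$-modules. Let $\kappa = \operatorname{card}(R) + \aleph_0$. Then the following conditions (i)-(iv) are equivalent: (i) $M$ is a flat $\mathcal Q$-Mittag-Leffler module. (ii) For each subset $C$ of $M$ of cardinality $\leq \kappa$, there exists a pure submodule $N$ of $M$ such that $N$ is flat and $\mathcal Q$-Mittag-Leffler, $C \subseteq N$, and $N$ has cardinality $\leq \kappa$. (iii) There exists a system $\mathcal S$ consisting of pure submodules of $M$ of cardinality $\leq \kappa$, each of which is flat and $\mathcal Q$-Mittag-Leffler, such that for each subset $C$ of $M$ of cardinality $\leq \kappa$ there is $N \in \mathcal S$ containing $C$, and $\mathcal S$ is closed under unions of well-ordered chains of length $\leq \kappa$. (iv) $M$ is a directed union of a direct system $\mathcal T$ consisting of flat $\mathcal Q$-Mittag-Leffler submodules of $M$, such that $\mathcal T$ is closed under unions of countable chains. Consider also the following condition: (v) There exists a system $\mathcal U$ consisting of countably presented flat $\mathcal Q$-Mittag-Leffler submodules $N$ of $M$ such that, for each $N \in \mathcal U$ and each left $R$-module $Q \in \mathcal Q$, the map $N \otimes_R Q \to M \otimes_R Q$ induced by the inclusion $N \hookrightarrow M$ is injective, and such that $\mathcal U$ satisfies the following two conditions: (a) for each countable subset $C$ of $M$ there is $N \in \mathcal U$ containing $C$, and (b) $\mathcal U$ is closed under unions of countable chains. Then (v) implies (i), and if $R \in \mathcal Q$, then (v) is equivalent to (i).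
   Context: Rings are associative with unit; ''module'' means right $R$-module unless specified otherwise. For a class $\mathcal Q$ of left $R$-modules, a module $M$ is $\mathcal Q$-Mittag-Leffler if the canonical map $M \otimes_R \prod_{i \in I} Q_i \to \prod_{i \in I} M \otimes_R Q_i$, $m \otimes (q_i)_{i\in I} \mapsto (m \otimes q_i)_{i \in I}$, is injective for every family $(Q_i \mid i \in I)$ of elements of $\mathcal Q$. In ''$R \in \mathcal Q$'', $R$ is the regular left $R$-module. Chains of submodules are taken with respect to inclusion. *)

(* Defs.v *)
From HB Require Import structures.
From mathcomp Require Import all_boot all_algebra.
From mathcomp Require Import boolp classical_sets functions cardinality wochoice.
From mathcomp Require Import freeg.

Set Implicit Arguments.
Unset Strict Implicit.
Unset Printing Implicit Defensive.

Import GRing.Theory.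

Local Open Scope classical_set_scope.
Local Open Scope card_scope.
Local Open Scope quotient_scope.
Local Open Scope ring_scope.

(* A right R-module is an lmodType over the converse ring R^c, a left
   R-module is an lmodType over R.  The zero ring is allowed (pzRingType). *)

(* M (x)_R A is the free abelian group on M * A modulo the subgroup
   generated by the bilinear, R-balanced relations. *)

Section Tensor.
Variables (R : pzRingType) (M : lmodType R^c) (A : lmodType R).

Local Notation F := {freeg (M * A)%type / int}.

Definition tensor_rel : set F := [set z |
  [\/ exists m m' a, z = << (m + m', a) >> - (<< (m, a) >> + << (m', a) >>),
      exists m a a', z = << (m, a + a') >> - (<< (m, a) >> + << (m, a') >>)
    | exists m (r : R) a, z = << ((r : R^c) *: m, a) >> - << (m, r *: a) >>]].

Definition tensor_ker : {pred F} := fun z =>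
  `[< forall S : zmodClosed F, (forall y, tensor_rel y -> y \in S) -> z \in S >].

Lemma tensor_ker_closed : zmod_closed tensor_ker.
Proof.
split=> [|x y /asboolP xS /asboolP yS]; apply/asboolP => S relS.
  exact: rpred0.
by apply: rpredB; [apply: xS|apply: yS].
Qed.

HB.instance Definition _ :=
  GRing.isZmodClosed.Build F tensor_ker tensor_ker_closed.

Definition tensor : zmodType := Quotient.quot tensor_ker.

Definition tens (m : M) (a : A) : tensor :=
  \pi_(Quotient.quot tensor_ker) << (m, a) >>.

(* The additive map m (x) a |-> b m a, provided b is biadditive and R-balanced;
   zmodule V is V as a module over int, which lets fglift extend b. *)
Definition tensor_lift (V : zmodType) (b : M -> A -> V) (t : tensor) : V :=
  fglift (fun x => b x.1 x.2 : zmodule V) (repr t).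

Definition balanced (V : zmodType) (b : M -> A -> V) :=
  [/\ forall m m' a, b (m + m') a = b m a + b m' a,
      forall m a a', b m (a + a') = b m a + b m a'
    & forall m (r : R) a, b ((r : R^c) *: m) a = b m (r *: a)].

Section LiftTheory.
Variables (V : zmodType) (b : M -> A -> V).
Hypothesis b_bal : balanced b.

Let L (z : F) : V := fglift (fun x => b x.1 x.2 : zmodule V) z.

Let LB x y : L (x - y) = L x - L y.
Proof. exact: (@lift_is_additive _ _ (zmodule V) (fun x => b x.1 x.2) x y). Qed.

Let L0 : L 0 = 0.
Proof. by have := LB 0 0; rewrite !subrr. Qed.

Let LD x y : L (x + y) = L x + L y.
Proof. by rewrite -[y in LHS]opprK LB -[- y]sub0r LB L0 sub0r opprK. Qed.

Let LU m a : L << (m, a) >> = b m a.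
Proof. by rewrite /L liftU scale1r. Qed.

Let kerL : {pred F} := fun z => L z == 0.

Let kerL_closed : zmod_closed kerL.
Proof.
split; rewrite ?inE ?/kerL /in_mem /= ?L0 // => x y /eqP Lx /eqP Ly.
by rewrite /in_mem /= /kerL LB Lx Ly subrr.
Qed.

Let tensor_ker_lift (z : F) : z \in tensor_ker -> L z = 0.
Proof.
pose K := GRing.isZmodClosed.Build F kerL kerL_closed.
pose S : zmodClosed F := HB.pack kerL K.
case: b_bal => bDl bDr bZ /asboolP /(_ S) kz; apply/eqP/kz => y.
by case=> -[m [? [? ->]]]; apply/eqP;
   rewrite LB ?LD !LU ?bDl ?bDr ?bZ subrr.
Qed.

Let tensor_lift_pi (z : F) :
  tensor_lift b (\pi_(Quotient.quot tensor_ker) z) = L z.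
Proof.
apply/eqP; rewrite -subr_eq0 -LB; apply/eqP/tensor_ker_lift.
by rewrite Quotient.idealrBE reprK.
Qed.

Lemma tensor_lift_tens m a : tensor_lift b (tens m a) = b m a.
Proof. by rewrite tensor_lift_pi LU. Qed.

Lemma tensor_lift_is_zmod_morphism : zmod_morphism (tensor_lift b).
Proof.
elim/quotW => x; elim/quotW => y.
by rewrite !tensor_lift_pi -LB -tensor_lift_pi raddfB.
Qed.

End LiftTheory.

Lemma tens_balanced : balanced tens.
Proof.
have relE (x y : F) : tensor_rel (x - y) ->
    \pi_(Quotient.quot tensor_ker) x = \pi y.
  move=> rxy; apply/eqP; rewrite -Quotient.idealrBE.
  by apply/asboolP => S; apply.
split=> [m m' a|m a a'|m r a].
- by rewrite /tens -raddfD; apply: relE; constructor 1; exists m, m', a.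
- by rewrite /tens -raddfD; apply: relE; constructor 2; exists m, a, a'.
- by apply: relE; constructor 3; exists m, r, a.
Qed.

End Tensor.

Section TensorMap.
Variable R : pzRingType.

Definition tensor_map (M M' : lmodType R^c) (A A' : lmodType R)
    (f : {linear M -> M'}) (g : {linear A -> A'}) : tensor M A -> tensor M' A' :=
  tensor_lift (fun m a => tens (f m) (g a)).

Section Theory.
Variables (M M' : lmodType R^c) (A A' : lmodType R).
Variables (f : {linear M -> M'}) (g : {linear A -> A'}).

Let bal : balanced (fun m a => tens (f m) (g a)).
Proof.
have [tDl tDr tZ] := tens_balanced M' A'.
by split=> *; rewrite ?linearD ?linearZ /= ?tDl ?tDr ?tZ.
Qed.

Lemma tensor_map_tens m a : tensor_map f g (tens m a) = tens (f m) (g a).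
Proof. exact: tensor_lift_tens. Qed.

Lemma tensor_map_is_zmod_morphism : zmod_morphism (tensor_map f g).
Proof. exact: tensor_lift_is_zmod_morphism. Qed.

End Theory.
End TensorMap.

Section ProdLmod.
Variables (R : pzRingType) (I : Type) (Q : I -> lmodType R).

Definition prod_lmod := forall i, Q i.

HB.instance Definition _ := Choice.on prod_lmod.

Let add (f g : prod_lmod) : prod_lmod := fun i => f i + g i.
Let zero : prod_lmod := fun i => 0.
Let opp (f : prod_lmod) : prod_lmod := fun i => - f i.
Let scale (r : R) (f : prod_lmod) : prod_lmod := fun i => r *: f i.

Let addA : associative add.
Proof. by move=> f g h; apply: functional_extensionality_dep => i; exact: addrA. Qed.
Let addC : commutative add.
Proof. by move=> f g; apply: functional_extensionality_dep => i; exact: addrC. Qed.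
Let add0 : left_id zero add.
Proof. by move=> f; apply: functional_extensionality_dep => i; exact: add0r. Qed.
Let addN : left_inverse zero opp add.
Proof. by move=> f; apply: functional_extensionality_dep => i; exact: addNr. Qed.

HB.instance Definition _ := GRing.isZmodule.Build prod_lmod addA addC add0 addN.

Let scaleA a b v : scale a (scale b v) = scale (a * b) v.
Proof. by apply: functional_extensionality_dep => i; exact: scalerA. Qed.
Let scale1 : left_id 1 scale.
Proof. by move=> v; apply: functional_extensionality_dep => i; exact: scale1r. Qed.
Let scaleDr : right_distributive scale +%R.
Proof. by move=> a u v; apply: functional_extensionality_dep => i; exact: scalerDr. Qed.
Let scaleDl v : {morph scale^~ v : a b / a + b}.
Proof. by move=> a b; apply: functional_extensionality_dep => i; exact: scalerDl. Qed.

HB.instance Definition _ :=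
  GRing.Zmodule_isLmodule.Build R prod_lmod scaleA scale1 scaleDr scaleDl.

Definition prod_proj (i : I) (f : prod_lmod) : Q i := f i.

Lemma prod_proj_is_linear i : linear (prod_proj i).
Proof. by []. Qed.

HB.instance Definition _ i :=
  GRing.isLinear.Build R prod_lmod (Q i) *:%R (prod_proj i) (prod_proj_is_linear i).

End ProdLmod.

(* A submodule is a predicate N : submodClosed V; submod N is the module it
   carries. *)

Section Submodule.
Variables (S : pzRingType) (V : lmodType S).

Record submod (N : submodClosed V) : Type :=
  Submod { submod_val : V; _ : submod_val \in N }.

Variable N : submodClosed V.

HB.instance Definition _ := [isSub for @submod_val N].
HB.instance Definition _ := [Choice of submod N by <:].
HB.instance Definition _ := [SubChoice_isSubLmodule of submod N by <:].

Definition incl : {linear submod N -> V} := \val.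

End Submodule.

Section FreeModule.
Variables (S : pzRingType) (I : Type).

Definition fin_supp : {pred I -> S^o} := fun f => `[< finite_set [set i | f i <> 0] >].

Lemma fin_supp_closed : submod_closed fin_supp.
Proof.
split; first by apply/asboolP; rewrite (_ : mkset _ = set0) //; apply/seteqP; split.
move=> a f g /asboolP fS /asboolP gS; apply/asboolP.
apply: sub_finite_set (_ : finite_set ([set i | f i <> 0] `|` [set i | g i <> 0])).
  move=> i /= nz; have [fi0|] := pselect (f i = 0); [right=> gi0|by left].
  by apply: nz; rewrite /GRing.add /= /GRing.scale /= fi0 gi0 scaler0 addr0.
by rewrite finite_setU.
Qed.

HB.instance Definition _ :=
  GRing.isSubmodClosed.Build S (I -> S^o) fin_supp fin_supp_closed.

Definition free_module : lmodType S := submod fin_supp.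

End FreeModule.

(* There is an exact sequence S^(J) -> S^(I) -> N -> 0, I and J countable. *)
Definition countably_presented (S : pzRingType) (N : lmodType S) :=
  exists (I J : countType) (g : {linear free_module S J -> free_module S I})
      (f : {linear free_module S I -> N}),
    (forall y, exists x, f x = y) /\
    (forall x, f x = 0 <-> exists y, g y = x).

Section RightModules.
Variable R : pzRingType.

(* M (x) - preserves monomorphisms of left R-modules. *)
Definition flat (M : lmodType R^c) :=
  forall (A B : lmodType R) (g : {linear A -> B}),
    injective g -> injective (tensor_map (idfun : {linear M -> M}) g).

Definition mittag_leffler_map (M : lmodType R^c) (I : Type) (Q : I -> lmodType R)
    (t : tensor M (prod_lmod Q)) : forall i, tensor M (Q i) :=
  fun i => tensor_map (idfun : {linear M -> M}) (@prod_proj R I Q i) t.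

Lemma mittag_leffler_map_tens M I (Q : I -> lmodType R) m (q : prod_lmod Q) :
  @mittag_leffler_map M I Q (tens m q) = fun i => tens m (q i).
Proof. by apply: functional_extensionality_dep => i; exact: tensor_map_tens. Qed.

Definition mittag_leffler (Qs : lmodType R -> Prop) (M : lmodType R^c) :=
  forall (I : Type) (Q : I -> lmodType R),
    (forall i, Qs (Q i)) -> injective (@mittag_leffler_map M I Q).

Definition flat_ML (Qs : lmodType R -> Prop) (M : lmodType R^c) :=
  flat M /\ mittag_leffler Qs M.

Variable M : lmodType R^c.
Implicit Types (N : submodClosed M) (C S : set (submodClosed M)).

Definition tensor_incl_inj (A : lmodType R) N :=
  injective (tensor_map (incl N) (idfun : {linear A -> A})).

Definition pure N := forall A : lmodType R, tensor_incl_inj A N.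

Definition submod_chain C := total_on C (fun N N' => {subset N <= N'}).

Definition countable_chain C := submod_chain C /\ countable C.

Definition well_ordered_chain C := submod_chain C /\
  forall D, D `<=` C -> D !=set0 ->
    exists2 N, D N & forall N', D N' -> {subset N <= N'}.

(* The cardinal of K, as an ordinal, is the least order type of a well-order
   on K; so a chain that is well-ordered by inclusion has length at most the
   cardinal of K iff it embeds in every well-order on K. *)
Definition length_le (K : Type) C := forall r : rel K, well_order r ->
  exists h : submodClosed M -> K,
    forall N N', C N -> C N' -> ({subset N <= N'} <-> r (h N) (h N')).

(* Only nonempty chains are considered: the empty union is not a submodule. *)
Definition closed_under_unions (P : set (submodClosed M) -> Prop) S :=
  forall C, C `<=` S -> C !=set0 -> P C ->
    exists2 N, S N & [set` N] = \bigcup_(N' in C) [set` N'].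

Definition directed S := S !=set0 /\
  forall N1 N2, S N1 -> S N2 ->
    exists N, [/\ S N, {subset N1 <= N} & {subset N2 <= N}].

End RightModules.

(* A type of cardinality card(R) + aleph_0. *)
Definition kappa (R : pzRingType) : Type := (R + nat)%type.

Definition card_le_kappa (R : pzRingType) (T : Type) (X : set T) : Prop :=
  X #<= [set: kappa R].

(* Main.v *)
Require Import Defs.
From HB Require Import structures.
From mathcomp Require Import all_boot all_algebra finmap.
From mathcomp Require Import boolp classical_sets functions cardinality wochoice.
From mathcomp Require Import freeg.

Set Implicit Arguments.
Unset Strict Implicit.
Unset Printing Implicit Defensive.

Import GRing.Theory.
Local Open Scope classical_set_scope.
Local Open Scope quotient_scope.
Local Open Scope ring_scope.

(** Everything is computed with finite tuples. Every element of M (x) A has the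
    form sum_k m_k (x) q_k, and it vanishes as soon as m = m' B for a tuple m' of
    M and a matrix B over R with B q = 0, because the matrix can be moved across
    the tensor sign. In general the vanishing of the tensor gives only a
    factorization of m padded with zeros ([tsum_eq0]); over a flat module the
    padding can be removed ([flat_vanish]). Two translations follow.
    Flatness is the equational criterion: a tuple m with sum_k m_k r_k = 0 factors
    through some B with B r = 0 ([flat_equational], [equational_flat]). And if M is
    flat and Q-Mittag-Leffler, each tuple m has one factorization m = m' B that is
    stable: B q = 0 for every q over every member of Q with sum_k m_k (x) q_k = 0
    ([ML_stable]); otherwise each factorization misses some q, and the product of
    these q contradicts injectivity of the canonical map.

    (i) implies (ii) and (iii). In a flat module, a submodule N such that every
    system m = m' B with m in N that is solvable in M is solvable in N is pure
    ([solution_closed_pure]), and pure submodules inherit flatness and the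
    Mittag-Leffler property ([flat_ML_pure]). A subset of cardinality at most kappa
    is closed under chosen solutions in countably many steps
    ([solution_closure]), and a chain of length at most kappa of such submodules
    has a small union ([card_chain_union]); both counts rest on
    kappa * kappa = kappa ([infinite_square]). Conversely, an element of a kernel
    involves finitely many elements of M, so it lies in a small pure submodule
    ([flat_ML_locally]).

    (iv) implies (i) is [flat_ML_union]. If no member of the system recognized all
    the vanishing sums over a tuple m, one could build an increasing sequence N_j in
    the system and elements q_j with sum m (x) q_j nonzero over N_j and zero over
    N_(j+1). Over the union, which is again flat and Q-Mittag-Leffler, the product
    of the q_j is then killed by one factorization of m, which lives in some N_j:
    a contradiction at index j.

    (v) implies (iv), since a system of countably generated submodules covering all
    countable subsets is directed ([countable_cover_directed]).

    (i) implies (v) when R is in Q. Iterating stable factorizations, while adding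
    the elements of a countable set one by one, gives m_j = m_(j+1) B_j
    ([stable_tower]). As R is in Q, a linear relation between the entries of m_j
    becomes trivial after applying B_j, so the submodule generated by all entries is
    the colimit of the finite free modules on the m_j. This makes it flat and
    countably presented, and stability makes it Q-Mittag-Leffler, with N (x) A
    mapping injectively to M (x) A for A in Q. Unions of countable chains of such
    submodules are treated by the same colimit argument
    ([colim_countably_presented]). *)

(** * Free modules *)

Section FreeLift.
Variables (S : pzRingType) (I : choiceType).
Local Notation F := (free_module S I).
Implicit Types (x y : F) (s : seq I).

Definition fcoef x (i : I) : S := (\val x) i.

Definition covers s x := forall i, fcoef x i != 0 -> i \in s.

Lemma fcoef_ext x y : fcoef x =1 fcoef y -> x = y.
Proof. by move=> xy; apply: val_inj; apply: funext => i; exact: xy. Qed.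

Lemma fcoefD x y i : fcoef (x + y) i = fcoef x i + fcoef y i.
Proof. by rewrite /fcoef linearD. Qed.

Lemma fcoefZ a x i : fcoef (a *: x) i = a * fcoef x i.
Proof. by rewrite /fcoef linearZ. Qed.

Lemma fcoef0 i : fcoef 0 i = 0.
Proof. by rewrite /fcoef linear0. Qed.

Lemma fcoefN x i : fcoef (- x) i = - fcoef x i.
Proof. by rewrite /fcoef linearN. Qed.

Lemma fcoef_sum (J : Type) (r : seq J) (P : pred J) (f : J -> F) i :
  fcoef (\sum_(j <- r | P j) f j) i = \sum_(j <- r | P j) fcoef (f j) i.
Proof. by elim/big_rec2: _ => [|j a b _ <-]; rewrite ?fcoef0 ?fcoefD. Qed.

Lemma free_supp x : exists2 s, uniq s & covers s x.
Proof.
case: x => f fP; have /asboolP/finite_fsetP[A fA] := fP.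
exists (enum_fset A); first exact: fset_uniq.
move=> i nz; have : [set i | f i <> 0] i by move=> /= fi0; move: nz; rewrite /fcoef /= fi0 eqxx.
by rewrite fA.
Qed.

Definition supp x : seq I := projT1 (cid2 (free_supp x)).

Lemma supp_uniq x : uniq (supp x).
Proof. by rewrite /supp; case: cid2. Qed.

Lemma supp_covers x : covers (supp x) x.
Proof. by rewrite /supp; case: cid2. Qed.

(** The sum runs over one chosen list containing the support; by [free_liftE] the
    choice is immaterial. *)
Definition free_lift (V : lmodType S) (g : I -> V) (x : F) : V :=
  \sum_(i <- supp x) fcoef x i *: g i.

(** Both lists, restricted to the nonzero coefficients, are permutations of the
    support. *)
Lemma free_liftE (V : lmodType S) (g : I -> V) x s :
  uniq s -> covers s x -> free_lift g x = \sum_(i <- s) fcoef x i *: g i.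
Proof.
have cov t : uniq t -> covers t x ->
    \sum_(i <- t) fcoef x i *: g i
      = \sum_(i <- [seq i <- undup (s ++ supp x) | fcoef x i != 0]) fcoef x i *: g i.
  move=> ut ct; rewrite (bigID (fun i => fcoef x i != 0)) /= [X in _ + X]big1; last first.
    by move=> i /negbNE /eqP ->; rewrite scale0r.
  rewrite addr0 -big_filter; apply: perm_big; apply: uniq_perm.
  - exact: filter_uniq.
  - by rewrite filter_uniq ?undup_uniq.
  move=> i; rewrite !mem_filter mem_undup mem_cat.
  by case: eqP => //= /eqP nz; rewrite ct // supp_covers // orbT.
by move=> us cs; rewrite /free_lift !cov //; [exact: supp_uniq|exact: supp_covers].
Qed.

Lemma covers_undup s t x : covers s x -> covers (undup (s ++ t)) x.
Proof. by move=> cs i /cs si; rewrite mem_undup mem_cat si. Qed.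

Lemma covers_undupr s t x : covers t x -> covers (undup (s ++ t)) x.
Proof. by move=> cs i /cs si; rewrite mem_undup mem_cat si orbT. Qed.

Lemma free_lift_is_linear (V : lmodType S) (g : I -> V) : linear (free_lift g).
Proof.
move=> a x y; pose s := undup (supp x ++ supp y).
have cx : covers s x by apply/covers_undup/supp_covers.
have cy : covers s y by apply/covers_undupr/supp_covers.
have us : uniq s by exact: undup_uniq.
rewrite !(@free_liftE _ g _ s) //; last first.
  move=> i; rewrite fcoefD fcoefZ; apply: contraR => si.
  have /eqP -> : fcoef x i == 0 by apply: contraNT si => /cx.
  have /eqP -> : fcoef y i == 0 by apply: contraNT si => /cy.
  by rewrite mulr0 addr0.
rewrite scaler_sumr -big_split /=; apply: eq_bigr => i _.
by rewrite fcoefD fcoefZ scalerDl scalerA.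
Qed.

HB.instance Definition _ (V : lmodType S) (g : I -> V) :=
  GRing.isLinear.Build S F V *:%R (free_lift g) (free_lift_is_linear g).

Lemma basis_subproof (i : I) :
  ((fun j => (j == i)%:R) : I -> S^o) \in @fin_supp S I.
Proof.
apply/asboolP; apply: (@sub_finite_set _ _ [set i]); last exact: finite_set1.
by move=> j /=; case: eqP.
Qed.

Definition basis (i : I) : F := Submod (basis_subproof i).

Lemma fcoef_basis i j : fcoef (basis i) j = (j == i)%:R.
Proof. by []. Qed.

Lemma free_lift_basis (V : lmodType S) (g : I -> V) i :
  free_lift g (basis i) = g i.
Proof.
rewrite (@free_liftE _ g _ [:: i]) //.
  by rewrite big_seq1 fcoef_basis eqxx scale1r.
by move=> j; rewrite fcoef_basis inE; case: (j == i) => //=; rewrite eqxx.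
Qed.

Lemma free_lift_id x : x = free_lift basis x.
Proof.
apply: fcoef_ext => i; rewrite /free_lift fcoef_sum.
have [si|nsi] := boolP (i \in supp x); last first.
  rewrite (_ : fcoef x i = 0); last by apply/eqP; apply: contraNT nsi => /supp_covers.
  rewrite big1_seq // => j /andP[_ sj]; rewrite fcoefZ fcoef_basis.
  have /negPf -> : i != j by apply: contraNneq nsi => ->.
  by rewrite mulr0.
rewrite (bigD1_seq i) //=; last exact: supp_uniq.
rewrite fcoefZ fcoef_basis eqxx mulr1 big1 ?addr0 // => j ji.
by rewrite fcoefZ fcoef_basis eq_sym (negPf ji) mulr0.
Qed.

(** Reduces every identity between linear maps on a free module, and every closure
    property, to the basis. *)
Lemma free_ind (P : F -> Prop) :
  P 0 -> (forall a x y, P x -> P y -> P (a *: x + y)) ->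
  (forall i, P (basis i)) -> forall x, P x.
Proof.
move=> P0 PD Pb x; rewrite [x]free_lift_id /free_lift.
by elim/big_ind: _ => // [y z Py Pz|i _]; [rewrite -[y]scale1r; apply: PD
  | rewrite -[_ *: _]addr0; apply: PD].
Qed.

End FreeLift.

(** * Vanishing of tensors *)

Section TensorElements.
Variables (R : pzRingType) (M : lmodType R^c) (A : lmodType R).
Local Notation F := {freeg (M * A)%type / int}.

Lemma tensDl (a : A) : {morph (fun m : M => tens m a) : x y / x + y}.
Proof. by move=> x y; have [-> _ _] := tens_balanced M A. Qed.

Lemma tensDr (m : M) : {morph (fun a : A => tens m a) : x y / x + y}.
Proof. by move=> x y; have [_ -> _] := tens_balanced M A. Qed.

Lemma tensZ (m : M) (r : R) (a : A) : tens ((r : R^c) *: m) a = tens m (r *: a).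
Proof. by have [_ _ ->] := tens_balanced M A. Qed.

Lemma tens0l (a : A) : tens (0 : M) a = 0.
Proof. by apply: (addrI (tens (0 : M) a)); rewrite -tensDl !addr0. Qed.

Lemma tens0r (m : M) : tens m (0 : A) = 0.
Proof. by apply: (addrI (tens m (0 : A))); rewrite -tensDr !addr0. Qed.

Lemma tensNl (m : M) (a : A) : tens (- m) a = - tens m a.
Proof. by apply/eqP; rewrite -addr_eq0 -tensDl addNr tens0l. Qed.

Lemma tens_suml (I : Type) (s : seq I) (m : I -> M) (a : A) :
  tens (\sum_(i <- s) m i) a = \sum_(i <- s) tens (m i) a.
Proof. exact: (big_morph _ (tensDl a) (tens0l a)). Qed.

Lemma tens_sumr (I : Type) (s : seq I) (m : M) (a : I -> A) :
  tens m (\sum_(i <- s) a i) = \sum_(i <- s) tens m (a i).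
Proof. exact: (big_morph _ (tensDr m) (tens0r m)). Qed.

(** The universal property of the tensor product with the quotient of [V] by the
    subgroup [P] as target; stating it with [P] avoids forming the quotient. *)
Lemma tens_sum_eq0 (V : zmodType) (b : M -> A -> V) (P : V -> Prop) :
  P 0 -> (forall x y, P x -> P y -> P (x - y)) ->
  (forall m m' a, P (b (m + m') a - (b m a + b m' a))) ->
  (forall m a a', P (b m (a + a') - (b m a + b m a'))) ->
  (forall m (r : R) a, P (b ((r : R^c) *: m) a - b m (r *: a))) ->
  forall s : seq (M * A), \sum_(p <- s) tens p.1 p.2 = 0 ->
    P (\sum_(p <- s) b p.1 p.2).
Proof.
move=> P0 PB PDl PDr PZ s s0.
pose L (z : F) : V := fglift (fun x => b x.1 x.2 : zmodule V) z.
have LB x y : L (x - y) = L x - L y.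
  exact: (@lift_is_additive _ _ (zmodule V) (fun x => b x.1 x.2) x y).
have L0 : L 0 = 0 by have := LB 0 0; rewrite !subrr.
have LD x y : L (x + y) = L x + L y.
  by rewrite -[y in LHS]opprK LB -[- y]sub0r LB L0 sub0r opprK.
have LU m a : L << (m, a) >> = b m a by rewrite /L liftU scale1r.
pose Pp : {pred F} := fun z => `[< P (L z) >].
have Pp_closed : zmod_closed Pp.
  split=> [|x y /asboolP Px /asboolP Py]; apply/asboolP; first by rewrite L0.
  by rewrite LB; apply: PB.
pose K := GRing.isZmodClosed.Build F Pp Pp_closed.
pose S : zmodClosed F := HB.pack Pp K.
pose z : F := \sum_(p <- s) << p >>.
have zE : L z = \sum_(p <- s) b p.1 p.2.
  by rewrite /z (big_morph L LD L0); apply: eq_bigr => -[m a] _; exact: LU.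
have pz : \pi_(Quotient.quot (@tensor_ker R M A)) z = 0.
  rewrite -s0 /z raddf_sum; apply: eq_bigr => -[m a] _ //.
have : z \in @tensor_ker R M A.
  rewrite -[z]subr0 Quotient.idealrBE; apply/eqP; rewrite pz.
  by rewrite raddf0.
move=> /asboolP /(_ S); rewrite -zE => /(_ _)/asboolP; apply => y.
by case=> -[m [? [? ->]]]; apply/asboolP; rewrite LB ?LD !LU.
Qed.

(** Integer coefficients are absorbed into the left factor of a pure tensor. *)
Lemma tensor_seq (t : tensor M A) :
  exists s : seq (M * A), t = \sum_(p <- s) tens p.1 p.2.
Proof.
elim/quotW: t => z; elim/freeg_ind_dom0: z => [|k [m a] D _ _ [s IH]].
  by exists [::]; rewrite big_nil raddf0.
exists ((m *~ k, a) :: s); rewrite big_cons raddfD /= -IH; congr (_ + _).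
rewrite -[k in << k *g _ >>]intz -freeg_mulz raddfMz /= -/(tens m a).
have nE n : tens (m *+ n) a = tens m a *+ n.
  by elim: n => [|n IHn]; rewrite ?mulr0n ?tens0l // !mulrS tensDl IHn.
by case: k => n; rewrite ?NegzE ?mulrNz ?tensNl -!pmulrn nE.
Qed.

End TensorElements.

(** * Tuples and matrices *)

Section Tuples.
Variables (R : pzRingType) (M : lmodType R^c).

Definition tsum (A : lmodType R) n (m : 'I_n -> M) (q : 'I_n -> A) : tensor M A :=
  \sum_k tens (m k) (q k).

(** The matrix identity m = m' B, with m and m' rows over the right module. *)
Definition factors n p (m : 'I_n -> M) (m' : 'I_p -> M) (B : 'I_p -> 'I_n -> R) :=
  forall k, m k = \sum_l (B l k : R^c) *: m' l.

Definition kills (A : lmodType R) n p (B : 'I_p -> 'I_n -> R) (q : 'I_n -> A) :=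
  forall l, \sum_k B l k *: q k = 0.

Definition matmul n p s (D : 'I_s -> 'I_p -> R) (B : 'I_p -> 'I_n -> R) :=
  fun l k => \sum_j D l j * B j k.

Lemma tensorP (A : lmodType R) (t : tensor M A) :
  exists n (m : 'I_n -> M) (q : 'I_n -> A), t = tsum m q.
Proof.
have [s ->] := tensor_seq t.
exists (size s), (fun k => (tnth (in_tuple s) k).1), (fun k => (tnth (in_tuple s) k).2).
by rewrite (big_tnth _ _ s).
Qed.

(** Associativity (m' B) (x) q = m' (x) (B q), the identity behind every vanishing
    argument below. *)
Lemma tsum_factor (A : lmodType R) n p (m : 'I_n -> M) (m' : 'I_p -> M) B
    (q : 'I_n -> A) :
  factors m m' B -> tsum m q = tsum m' (fun l => \sum_k B l k *: q k).
Proof.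
move=> mE; rewrite /tsum; under eq_bigr => k _ do rewrite mE tens_suml.
under [RHS]eq_bigr => l _ do rewrite tens_sumr.
rewrite exchange_big; apply: eq_bigr => l _; apply: eq_bigr => k _.
exact: tensZ.
Qed.

Lemma tsum_kills (A : lmodType R) n p (m : 'I_n -> M) (m' : 'I_p -> M) B
    (q : 'I_n -> A) :
  factors m m' B -> kills B q -> tsum m q = 0.
Proof.
move=> /tsum_factor -> Bq; rewrite /tsum big1 // => l _.
by rewrite Bq tens0r.
Qed.

Lemma factors_trans n p s (m : 'I_n -> M) (m' : 'I_p -> M) (m'' : 'I_s -> M) B D :
  factors m m' B -> factors m' m'' D -> factors m m'' (matmul D B).
Proof.
move=> mE m'E k; rewrite mE.
under eq_bigr => l _ do rewrite m'E scaler_sumr.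
rewrite exchange_big; apply: eq_bigr => j _; rewrite /matmul.
rewrite (_ : \sum_j0 D j j0 * B j0 k = \sum_j0 ((B j0 k : R^c) * (D j j0 : R^c)) :> R^c) //.
by rewrite scaler_suml; apply: eq_bigr => l _; rewrite scalerA.
Qed.

Lemma kills_matmul (A : lmodType R) n p s (D : 'I_s -> 'I_p -> R)
    (B : 'I_p -> 'I_n -> R) (q : 'I_n -> A) :
  kills B q -> kills (matmul D B) q.
Proof.
move=> Bq l; rewrite /matmul.
under eq_bigr => k _ do rewrite scaler_suml.
rewrite exchange_big big1 //= => j _.
under eq_bigr => k _ do rewrite -scalerA.
by rewrite -scaler_sumr Bq scaler0.
Qed.

Lemma kills_assoc (A : lmodType R) n p s
    (D : 'I_s -> 'I_p -> R) (B : 'I_p -> 'I_n -> R) (q : 'I_n -> A) :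
  kills D (fun l => \sum_k B l k *: q k) -> kills (matmul D B) q.
Proof.
move=> Dq l; rewrite -[RHS](Dq l) /matmul.
under eq_bigr => k _ do rewrite scaler_suml.
rewrite exchange_big; apply: eq_bigr => j _; rewrite scaler_sumr.
by apply: eq_bigr => k _; rewrite scalerA.
Qed.

Lemma factors_id n (m : 'I_n -> M) : factors m m (fun l k => (l == k)%:R).
Proof.
move=> k; rewrite (bigD1 k) //= eqxx big1 => [|l /negPf ->]; rewrite ?scale0r //.
by rewrite scale1r addr0.
Qed.

Section Vanishing.
Variables (A : lmodType R) (n : nat) (m : 'I_n -> M) (q : 'I_n -> A).

Let J : choiceType := ('I_n + A)%type.
Let g (j : J) : A := match j with inl k => q k | inr a => a end.
Let act (x : M) (rho : free_module R J) : J -> M := fun j => (fcoef rho j : R^c) *: x.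
Let rels (f : J -> M) := exists2 s : seq (M * free_module R J),
  {in s, forall p, free_lift g p.2 = 0} & f = \sum_(p <- s) act p.1 p.2.

Let relsB f f' : rels f -> rels f' -> rels (f - f').
Proof.
move=> [s sg ->] [s' s'g ->].
exists (s ++ [seq (- p.1, p.2) | p <- s']).
  move=> p; rewrite mem_cat => /orP[/sg//|/mapP[p' /s'g ? ->]] //.
rewrite big_cat big_map /= -sumrN; congr (_ + _); apply: eq_bigr => p _.
by apply: funext => j; rewrite /act scalerN.
Qed.

Let rels_act x rho : free_lift g rho = 0 -> rels (act x rho).
Proof.
move=> rho0; exists [:: (x, rho)]; last by rewrite big_seq1.
by move=> p; rewrite inE => /eqP ->.
Qed.

Let rels0 : rels 0.
Proof. by exists [::]; rewrite ?big_nil. Qed.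

(** Present [A] by the generators [inr a], for a in [A], and one extra generator
    [inl k] for each [q k]. As (x) is right exact, M (x) A is the quotient of the
    sums of copies of [M] by the multiples of the relations [rho] of this
    presentation. So the element m of the copies indexed by the [inl k] is a
    combination of relations; reading off coefficients at [inl k] gives
    [factors m m' B], and at [inr a] the zero columns [C]. *)
Lemma tsum_eq0 : tsum m q = 0 ->
  exists p (m' : 'I_p -> M) (B : 'I_p -> 'I_n -> R) (s : seq A) (C : 'I_p -> A -> R),
    [/\ factors m m' B, forall a, \sum_l (C l a : R^c) *: m' l = 0
      & forall l, \sum_k B l k *: q k + \sum_(a <- s) C l a *: a = 0].
Proof.
move=> t0; pose b (x : M) (a : A) := act x (basis R (inr a : J)).
have actD x y rho : act (x + y) rho = act x rho + act y rho.
  by apply: funext => j; exact: scalerDr.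
have actB x rho rho' : act x (rho - rho') = act x rho - act x rho'.
  by apply: funext => j; rewrite /act fcoefD fcoefN scalerBl.
have relsD f f' : rels f -> rels f' -> rels (f + f').
  by move=> fr f'r; have := relsB fr (relsB rels0 f'r); rewrite sub0r opprK.
(* Sending x (x) a to x at [inr a] respects the defining relations of the tensor
   product modulo [rels]. *)
have : rels (\sum_(p <- [seq (m k, q k) | k <- enum 'I_n]) b p.1 p.2).
  apply: tens_sum_eq0 => //.
  - by move=> x y a; rewrite /b actD subrr.
  - move=> x a a'; rewrite /b.
    rewrite (_ : _ - _ = act x (basis R (inr (a + a')) - basis R (inr a) - basis R (inr a'))).
      apply: rels_act; rewrite !linearB /= !free_lift_basis /=.
      by rewrite -addrA -opprD subrr.
    by rewrite !actB opprD addrA.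
  - move=> x r a; rewrite /b.
    rewrite (_ : _ - _ = act x (r *: basis R (inr a) - basis R (inr (r *: a)))).
      by apply: rels_act; rewrite linearB linearZ /= !free_lift_basis subrr.
    rewrite actB; congr (_ - _); apply: funext => j.
    by rewrite /act fcoefZ scalerA.
  by rewrite big_map big_enum /=.
rewrite big_map big_enum /= => bm.
(* [inl k - inr (q k)] is a relation, so [inr (q k)] may be replaced by [inl k]. *)
have : rels (\sum_k act (m k) (basis R (inl k : J))).
  rewrite -[X in rels X](subrK (\sum_k b (m k) (q k))).
  apply: (relsD) => //; rewrite -sumrB.
  elim/big_ind: _ => // k _; rewrite -actB; apply: rels_act.
  by rewrite linearB /= !free_lift_basis subrr.
case=> s sg sE.
pose mm l : M := (tnth (in_tuple s) l).1.
pose rr l : free_module R J := (tnth (in_tuple s) l).2.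
have rr0 l : free_lift g (rr l) = 0 by apply: sg; apply: mem_tnth.
have ev j : \sum_k (fcoef (basis R (inl k : J)) j : R^c) *: m k
    = \sum_l (fcoef (rr l) j : R^c) *: mm l.
  move/(congr1 (fun f => f j)): sE; rewrite !fct_sumE => ->.
  by rewrite (big_tnth _ _ s).
pose T : seq A := undup (pmap (fun j : J => if j is inr a then Some a else None)
   (flatten [seq supp (rr l) | l <- enum 'I_(size s)])).
exists (size s), mm, (fun l k => fcoef (rr l) (inl k)), T, (fun l a => fcoef (rr l) (inr a)).
split.
- move=> k; rewrite -ev (bigD1 k) //= fcoef_basis eqxx scale1r big1 ?addr0 // => i ik.
  rewrite fcoef_basis (_ : _ == _ = false) ?scale0r //.
  by apply/eqP => -[] /eqP; rewrite eq_sym (negPf ik).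
- by move=> a; rewrite -ev big1 // => k _; rewrite scale0r.
- move=> l; rewrite -[RHS](rr0 l).
  rewrite (@free_liftE _ _ _ _ _ ([seq inl k | k <- enum 'I_n] ++ [seq inr a | a <- T])).
  + by rewrite big_cat big_map big_enum; congr (_ + _); rewrite big_map.
  + rewrite cat_uniq; apply/and3P; split.
    * by rewrite map_inj_uniq ?enum_uniq // => ? ? [].
    * by rewrite -all_predC all_map; apply/allP => a _ /=; apply/mapP => -[].
    * by rewrite map_inj_uniq ?undup_uniq // => ? ? [].
  move=> [k|a] nz; rewrite mem_cat; first by rewrite map_f ?mem_enum.
  apply/orP; right; apply: map_f; rewrite mem_undup mem_pmap.
  apply/mapP; exists (inr a) => //; apply/flattenP; exists (supp (rr l)).
    by apply: map_f; rewrite mem_enum.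
  exact: supp_covers.
Qed.

End Vanishing.

End Tuples.

(** * Flatness and the equational criterion *)

Lemma submod_from (S : pzRingType) (V : lmodType S) (P : V -> Prop) :
  P 0 -> (forall a x y, P x -> P y -> P (a *: x + y)) ->
  exists N : submodClosed V, forall x, (x \in N) <-> P x.
Proof.
move=> P0 PD; pose Pp : {pred V} := fun x => `[< P x >].
have Pp_closed : submod_closed Pp.
  split=> [|a x y /asboolP Px /asboolP Py]; apply/asboolP => //.
  exact: PD.
pose K := GRing.isSubmodClosed.Build S V Pp Pp_closed.
pose N : submodClosed V := HB.pack Pp K.
by exists N => x; split=> [/asboolP|Px] //; apply/asboolP.
Qed.

Section TensorMaps.
Variables (R : pzRingType) (M M' : lmodType R^c) (A A' : lmodType R).
Variables (f : {linear M -> M'}) (g : {linear A -> A'}).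

Lemma tensor_mapB t u :
  tensor_map f g (t - u) = tensor_map f g t - tensor_map f g u.
Proof. exact: tensor_map_is_zmod_morphism. Qed.

Lemma tensor_map0 : tensor_map f g 0 = 0.
Proof. by have := tensor_mapB 0 0; rewrite !subrr. Qed.

Lemma tensor_mapD t u :
  tensor_map f g (t + u) = tensor_map f g t + tensor_map f g u.
Proof.
by rewrite -[u in LHS]opprK tensor_mapB -[- u]sub0r tensor_mapB tensor_map0 sub0r opprK.
Qed.

Lemma tensor_map_tsum n (m : 'I_n -> M) (q : 'I_n -> A) :
  tensor_map f g (tsum m q) = tsum (f \o m) (g \o q).
Proof.
rewrite /tsum (big_morph _ tensor_mapD tensor_map0).
by apply: eq_bigr => k _; rewrite tensor_map_tens.
Qed.

(** Turns each injectivity condition into a statement on tuples. *)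
Lemma tensor_map_inj :
  injective (tensor_map f g) <->
  forall n (m : 'I_n -> M) (q : 'I_n -> A),
    tsum (f \o m) (g \o q) = 0 -> tsum m q = 0.
Proof.
split=> [inj n m q t0|H t u tu].
  by apply: inj; rewrite tensor_map_tsum t0 tensor_map0.
apply/eqP; rewrite -subr_eq0; have [n [m [q tuE]]] := tensorP (t - u).
rewrite tuE; apply/eqP/H.
by rewrite -tensor_map_tsum -tuE tensor_mapB tu subrr.
Qed.

End TensorMaps.

Section Flatness.
Variable R : pzRingType.
Implicit Types M : lmodType R^c.

Definition equational M := forall n (m : 'I_n -> M) (r : 'I_n -> R),
  \sum_k (r k : R^c) *: m k = 0 ->
  exists p (m' : 'I_p -> M) (B : 'I_p -> 'I_n -> R),
    factors m m' B /\ kills B (r : 'I_n -> R^o).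

(** By flatness the sum already vanishes over the submodule spanned by [q]. There
    the auxiliary elements given by [tsum_eq0] are combinations D q, and [B + C D]
    is the required matrix, because m' C = 0. *)
Lemma flat_vanish M : flat M ->
  forall (A : lmodType R) n (m : 'I_n -> M) (q : 'I_n -> A), tsum m q = 0 ->
  exists p (m' : 'I_p -> M) (B : 'I_p -> 'I_n -> R), factors m m' B /\ kills B q.
Proof.
move=> flM A n m q t0.
have [||N NE] := @submod_from R A (fun a => exists r : 'I_n -> R, a = \sum_k r k *: q k).
- by exists (fun=> 0); rewrite big1 // => k _; rewrite scale0r.
- move=> a x y [r ->] [s ->]; exists (fun k => a * r k + s k).
  rewrite scaler_sumr -big_split; apply: eq_bigr => k _ /=.
  by rewrite scalerDl scalerA.
have qN k : q k \in N.
  apply/NE; exists (fun j => (j == k)%:R).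
  rewrite (bigD1 k) //= eqxx scale1r big1 ?addr0 // => j /negPf ->.
  by rewrite scale0r.
pose q' k : submod N := Submod (qN k).
have : tsum m q' = 0.
  have /tensor_map_inj := flM _ _ (Defs.incl N) val_inj; apply.
  exact: t0.
move=> /tsum_eq0[p [m' [B [s [C [mE C0 BC]]]]]].
have /choice[D DE] (a : submod N) : exists r : 'I_n -> R, \val a = \sum_k r k *: q k.
  exact: (NE _).1 (valP a).
exists p, m', (fun l k => B l k + \sum_(a <- s) C l a * D a k); split.
  move=> k; rewrite [LHS]mE.
  under [RHS]eq_bigr => l _.
    rewrite [(_ + _ : R^c) *: _](@scalerDl R^c).
    over.
  rewrite big_split /= -[LHS]addr0; congr (_ + _).
  have -> : \sum_l (\sum_(a <- s) C l a * D a k : R^c) *: m' l =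
      \sum_(a <- s) (D a k : R^c) *: \sum_l (C l a : R^c) *: m' l.
    under eq_bigr => l _ do rewrite (@scaler_suml R^c).
    rewrite exchange_big; apply: eq_bigr => a _; rewrite scaler_sumr.
    by apply: eq_bigr => l _; rewrite scalerA.
  by rewrite big1 // => a _; rewrite C0 scaler0.
move=> l; have := congr1 (Defs.incl N) (BC l); rewrite linearD linear0 !linear_sum => BC0.
rewrite -[RHS]BC0.
under eq_bigr => k _ do rewrite scalerDl.
rewrite big_split /=; congr (_ + _).
under eq_bigr => k _ do rewrite scaler_suml.
rewrite exchange_big; apply: eq_bigr => a _.
rewrite -[submod_val a]/(\val a) DE scaler_sumr; apply: eq_bigr => k _.
by rewrite scalerA.
Qed.

Lemma tsum_regular M n (m : 'I_n -> M) (r : 'I_n -> R^o) :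
  tsum m r = tens (\sum_k (r k : R^c) *: m k) (1 : R^o).
Proof.
rewrite tens_suml; apply: eq_bigr => k _; rewrite tensZ.
by congr tens; rewrite /GRing.scale /= mulr1.
Qed.

(** A linear relation is the vanishing of a tensor with values in [R^o]. *)
Lemma flat_equational M : flat M -> equational M.
Proof.
move=> flM n m r r0; apply: flat_vanish => //.
by rewrite tsum_regular r0 tens0l.
Qed.

(** Several relations are killed one after the other: the remaining ones are
    carried along through the factorization that kills the first. *)
Lemma equational_seq M : equational M ->
  forall (T : eqType) (s : seq T) n (m : 'I_n -> M) (c : T -> 'I_n -> R),
  (forall a, a \in s -> \sum_k (c a k : R^c) *: m k = 0) ->
  exists p (m' : 'I_p -> M) (B : 'I_p -> 'I_n -> R),
    factors m m' B /\ forall a, a \in s -> kills B (c a : 'I_n -> R^o).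
Proof.
move=> eqM T; elim=> [|b s IH] n m c c0.
  by exists n, m, (fun l k => (l == k)%:R); split=> //; exact: factors_id.
have [p [m' [B [mE Bc]]]] := eqM n m (c b) (c0 b (mem_head b s)).
have [|p' [m'' [D [m'E Dc]]]] :=
  IH p m' (fun a l => \sum_k B l k * c a k).
  move=> a sa; rewrite -[RHS](c0 a); last by rewrite inE sa orbT.
  under [RHS]eq_bigr => k _ do rewrite mE scaler_sumr.
  rewrite exchange_big; apply: eq_bigr => l _; rewrite (@scaler_suml R^c).
  by apply: eq_bigr => k _; rewrite scalerA.
exists p', m'', (matmul D B); split; first exact: factors_trans mE m'E.
move=> a; rewrite inE => /orP[/eqP ->|sa]; first exact: kills_matmul.
exact: (@kills_assoc R R^o) (Dc a sa).
Qed.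

(** The vanishing over [B] gives m = m' C and m' D = 0. Killing the columns of [D]
    by m' = m'' E leaves E C (g q) = 0, hence E C q = 0 as [g] is injective. *)
Lemma equational_flat M : equational M -> flat M.
Proof.
move=> eqM A B g g_inj; apply/tensor_map_inj => n m q.
move=> /tsum_eq0[p [m' [C [s [D [mE D0 CD]]]]]].
have [|p' [m'' [E [m'E ED]]]] :=
  @equational_seq M eqM B s p m' (fun a l => D l a).
  by move=> a _; exact: D0.
apply: (tsum_kills (factors_trans mE m'E)) => l.
apply: g_inj; rewrite linear0 linear_sum /= /matmul.
have CDl j : \sum_k C j k *: g (q k) = - \sum_(a <- s) D j a *: a.
  by apply/eqP; rewrite -addr_eq0; apply/eqP/CD.
under eq_bigr => k _ do rewrite linearZ /= scaler_suml.
rewrite exchange_big /=.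
under eq_bigr => j _.
  under eq_bigr => k _ do rewrite -scalerA.
  rewrite -scaler_sumr CDl scalerN scaler_sumr.
  over.
rewrite sumrN exchange_big /= big1_seq ?oppr0 // => a /andP[_ sa].
under eq_bigr => j _ do rewrite scalerA.
by rewrite -scaler_suml (ED a sa) scale0r.
Qed.

End Flatness.

(** * Mittag-Leffler modules and directed unions of submodules *)

Section MittagLeffler.
Variables (R : pzRingType) (Q : lmodType R -> Prop).

Lemma mittag_lefflerP (M : lmodType R^c) :
  mittag_leffler Q M <->
  forall (I : Type) (Qs : I -> lmodType R), (forall i, Q (Qs i)) ->
  forall n (m : 'I_n -> M) (q : 'I_n -> prod_lmod Qs),
    (forall i, tsum m (fun k => q k i) = 0) -> tsum m q = 0.
Proof.
split=> [ML I Qs QQs n m q q0|H I Qs QQs t u tu].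
  apply: (ML I Qs QQs); apply: functional_extensionality_dep => i.
  by rewrite /mittag_leffler_map tensor_map_tsum tensor_map0; exact: q0.
apply/eqP; rewrite -subr_eq0; have [n [m [q tuE]]] := tensorP (t - u).
rewrite tuE; apply/eqP/H => // i.
have := congr1 (fun f => f i) tu; rewrite /mittag_leffler_map => tui.
have : tensor_map (idfun : {linear M -> M}) (@prod_proj R I Qs i) (tsum m q) = 0.
  by rewrite -tuE tensor_mapB tui subrr.
by rewrite tensor_map_tsum.
Qed.

Lemma kills_prod (I : Type) (Qs : I -> lmodType R) n p (B : 'I_p -> 'I_n -> R)
    (q : 'I_n -> prod_lmod Qs) : kills B q -> forall i, kills B (fun k => q k i).
Proof.
move=> Bq i l; have := congr1 (@prod_proj R I Qs i) (Bq l).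
rewrite linear0 linear_sum => Bi; rewrite -[RHS]Bi.
by apply: eq_bigr => k _; rewrite linearZ.
Qed.

(** Injectivity passes to the first factor of a composite: both canonical maps for
    [N] are followed by the map to their counterparts for [M]. *)
Lemma flat_ML_pure_map (M N : lmodType R^c) (f : {linear N -> M}) :
  (forall (A : lmodType R), injective (tensor_map f (idfun : {linear A -> A}))) ->
  flat_ML Q M -> flat_ML Q N.
Proof.
move=> f_inj [flM MLM]; split.
  move=> A B g g_inj; apply/tensor_map_inj => n m q t0.
  have /tensor_map_inj := f_inj A; apply.
  have /tensor_map_inj := flM A B g g_inj; apply.
  rewrite -[RHS](tensor_map0 f (idfun : {linear B -> B})) -[in RHS]t0.
  by rewrite tensor_map_tsum.
apply/mittag_lefflerP => I Qs QQs n m q q0.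
have /tensor_map_inj := f_inj (prod_lmod Qs); apply.
have /mittag_lefflerP ML := MLM; apply: ML => // i.
by rewrite -[RHS](tensor_map0 f (idfun : {linear Qs i -> Qs i})) -(q0 i) tensor_map_tsum.
Qed.

End MittagLeffler.

Section Submodules.
Variables (R : pzRingType) (M : lmodType R^c).
Implicit Types (N : submodClosed M) (A : lmodType R).

Lemma val_comb N (I : Type) (s : seq I) (a : I -> R^c) (v : I -> submod N) :
  submod_val (\sum_(i <- s) a i *: v i) = \sum_(i <- s) a i *: submod_val (v i).
Proof. exact: (linear_sum (Defs.incl N)). Qed.

(** Tuples are kept in [M] so that the same tuple can be compared over different
    submodules. *)
Definition vanish_in N A n (m : 'I_n -> M) (q : 'I_n -> A) :=
  exists2 mN : 'I_n -> submod N, (forall k, val (mN k) = m k) & tsum mN q = 0.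

Lemma vanish_inE N A n (mN : 'I_n -> submod N) (q : 'I_n -> A) :
  vanish_in N (val \o mN) q -> tsum mN q = 0.
Proof.
by case=> mN' mE <-; congr tsum; apply: funext => k; apply: val_inj; rewrite mE.
Qed.

Lemma vanish_in_top N A n (m : 'I_n -> M) (q : 'I_n -> A) :
  vanish_in N m q -> tsum m q = 0.
Proof.
case=> mN mE q0.
rewrite -[RHS](tensor_map0 (Defs.incl N) (idfun : {linear A -> A})) -q0.
by rewrite tensor_map_tsum; congr tsum; apply: funext => k; rewrite -mE.
Qed.

Definition submod_le N N' (sNN' : {subset N <= N'}) (x : submod N) : submod N' :=
  Submod (sNN' _ (valP x)).

Lemma submod_le_is_linear N N' (sNN' : {subset N <= N'}) :
  linear (submod_le sNN').
Proof. by move=> a x y; apply: val_inj. Qed.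

HB.instance Definition _ N N' (sNN' : {subset N <= N'}) :=
  GRing.isLinear.Build R^c (submod N) (submod N') *:%R (submod_le sNN')
    (submod_le_is_linear sNN').

Lemma vanish_in_mono N N' A n (m : 'I_n -> M) (q : 'I_n -> A) :
  {subset N <= N'} -> vanish_in N m q -> vanish_in N' m q.
Proof.
move=> sNN' [mN mE q0]; exists (submod_le sNN' \o mN) => [k|]; first exact: mE.
rewrite -[RHS](tensor_map0 (submod_le sNN') (idfun : {linear A -> A})) -q0.
by rewrite tensor_map_tsum.
Qed.

Lemma vanish_in_kills N A n p (m : 'I_n -> M) (m' : 'I_p -> M) B (q : 'I_n -> A) :
  (forall l, m' l \in N) -> factors m m' B -> kills B q -> vanish_in N m q.
Proof.
move=> m'N mE Bq.
have mN k : m k \in N.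
  rewrite mE; apply: (@rpred_sum _ N) => l _.
  exact: rpredZ.
exists (fun k => Submod (mN k)) => //.
apply: (@tsum_kills _ _ _ _ _ _ (fun l => Submod (m'N l))); last exact: Bq.
by move=> k; apply: val_inj; rewrite /= val_comb; exact: mE.
Qed.

Lemma vanish_in_flat N A n (m : 'I_n -> M) (q : 'I_n -> A) :
  flat (submod N) -> vanish_in N m q ->
  exists p (m' : 'I_p -> M) (B : 'I_p -> 'I_n -> R),
    [/\ forall l, m' l \in N, factors m m' B & kills B q].
Proof.
move=> flN [mN mE /(flat_vanish flN)[p [m' [B [mN' Bq]]]]].
exists p, (val \o m'), B; split=> // [l|k]; first exact: (valP (m' l)).
by rewrite -mE mN' /= val_comb.
Qed.

Lemma tensor_incl_injP N A :
  tensor_incl_inj A N <->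
  forall n (m : 'I_n -> M) (q : 'I_n -> A), (forall k, m k \in N) ->
    tsum m q = 0 -> vanish_in N m q.
Proof.
rewrite /tensor_incl_inj tensor_map_inj; split=> H n m q.
  by move=> mN m0; exists (fun k => Submod (mN k)) => //; apply: H.
by move=> m0; apply/vanish_inE/H => // k; exact: (valP (m k)).
Qed.

Lemma mittag_leffler_submodP (Q : lmodType R -> Prop) N :
  mittag_leffler Q (submod N) <->
  forall (I : Type) (Qs : I -> lmodType R), (forall i, Q (Qs i)) ->
  forall n (m : 'I_n -> M) (q : 'I_n -> prod_lmod Qs), (forall k, m k \in N) ->
    (forall i, vanish_in N m (fun k => q k i)) -> vanish_in N m q.
Proof.
rewrite mittag_lefflerP; split=> H I Qs QQs n m q.
  move=> mN q0; exists (fun k => Submod (mN k)) => //; apply: H => // i.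
  exact/vanish_inE/q0.
move=> q0; apply/vanish_inE/H => // [k|i]; first exact: (valP (m k)).
by exists m; last exact: q0.
Qed.

Lemma equational_submodP N :
  equational (submod N) <->
  forall n (m : 'I_n -> M) (r : 'I_n -> R), (forall k, m k \in N) ->
    \sum_k (r k : R^c) *: m k = 0 ->
  exists p (m' : 'I_p -> M) (B : 'I_p -> 'I_n -> R),
    [/\ forall l, m' l \in N, factors m m' B & kills B (r : 'I_n -> R^o)].
Proof.
split=> H n m r.
  move=> mN r0; have [|p [m' [B [mE Br]]]] := H n (fun k => Submod (mN k)) r.
    by apply: val_inj; rewrite /= val_comb.
  exists p, (val \o m'), B; split=> // [l|k]; first exact: (valP (m' l)).
  by have := congr1 val (mE k); rewrite /= val_comb.
move=> r0; have [||p [m' [B [m'N mE Br]]]] := H n (val \o m) r.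
- by move=> k; exact: (valP (m k)).
- by have := congr1 val r0; rewrite /= val_comb.
exists p, (fun l => Submod (m'N l)), B; split=> // k.
by apply: val_inj; rewrite /= val_comb; exact: mE.
Qed.

Lemma flat_ML_pure (Q : lmodType R -> Prop) N :
  pure N -> flat_ML Q M -> flat_ML Q (submod N).
Proof. by move=> pN; apply: flat_ML_pure_map => A; exact: pN. Qed.

(** The isomorphism from [M] onto the full submodule is a pure map. *)
Lemma flat_ML_top (Q : lmodType R -> Prop) N :
  (forall x, x \in N) -> flat_ML Q (submod N) -> flat_ML Q M.
Proof.
move=> NT; pose f x : submod N := Submod (NT x).
have f_lin : linear f by move=> a x y; apply: val_inj.
pose fL := GRing.isLinear.Build R^c M (submod N) *:%R f f_lin.
pose F : {linear M -> submod N} := HB.pack f fL.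
apply: (@flat_ML_pure_map _ _ _ _ F) => A; apply/tensor_map_inj => n m q.
move=> mq0; apply: (@vanish_in_top N).
by exists (F \o m).
Qed.

Definition is_union (D : set (submodClosed M)) N :=
  forall x, x \in N <-> exists2 N', D N' & x \in N'.

Lemma directed_union (D : set (submodClosed M)) : directed D -> exists N, is_union D N.
Proof.
move=> [[N0 DN0] dirD].
apply: (@submod_from _ M (fun x => exists2 N', D N' & x \in N')).
  by exists N0; rewrite // rpred0.
move=> a x y [N1 D1 x1] [N2 D2 y2]; have [N [DN s1 s2]] := dirD _ _ D1 D2.
exists N => //; apply: rpredD; [exact: rpredZ (s1 _ x1)|exact: s2].
Qed.

Lemma chain_directed (D : set (submodClosed M)) : D !=set0 -> submod_chain D -> directed D.
Proof.
move=> D0 chD; split=> // N1 N2 D1 D2.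
by have [s12|s21] := chD _ _ D1 D2; [exists N2; split|exists N1; split].
Qed.

Section DirectedUnion.
Variables (D : set (submodClosed M)) (N : submodClosed M).
Hypotheses (dirD : directed D) (uN : is_union D N).

Lemma union_sub N' : D N' -> {subset N' <= N}.
Proof. by move=> DN' x xN'; apply/uN; exists N'. Qed.

Lemma union_finite n (m : 'I_n -> M) : (forall k, m k \in N) ->
  exists2 N', D N' & forall k, m k \in N'.
Proof.
elim: n m => [|n IH] m mN; have [[N0 DN0] dD] := dirD.
  by exists N0 => // -[].
have [k|N1 DN1 mN1] := IH (fun k => m (fintype.lift ord0 k)); first exact: mN.
have /uN[N2 DN2 m0N2] := mN ord0.
have [N3 [DN3 s1 s2]] := dD _ _ DN1 DN2.
exists N3 => // k; case: (unliftP ord0 k) => [j|] ->; [exact/s1/mN1|exact/s2].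
Qed.

Lemma union_finite_above N0 n (m : 'I_n -> M) : D N0 -> (forall k, m k \in N) ->
  exists N', [/\ D N', {subset N0 <= N'} & forall k, m k \in N'].
Proof.
move=> DN0 /union_finite[N1 DN1 mN1].
have [N2 [DN2 s0 s1]] := dirD.2 _ _ DN0 DN1.
exists N2; split=> // k; exact/s1/mN1.
Qed.

Lemma flat_union : (forall N', D N' -> flat (submod N')) -> flat (submod N).
Proof.
move=> flD; apply/equational_flat/equational_submodP => n m r mN r0.
have [N' DN' mN'] := union_finite mN.
have /flat_equational/equational_submodP := flD _ DN'.
move=> /(_ n m r mN' r0)[p [m' [B [m'N' mE Br]]]].
by exists p, m', B; split=> // l; apply: union_sub DN' _ _.
Qed.

Lemma tensor_incl_inj_union A : (forall N', D N' -> tensor_incl_inj A N') ->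
  tensor_incl_inj A N.
Proof.
move=> pD; apply/tensor_incl_injP => n m q mN m0.
have [N' DN' mN'] := union_finite mN.
have /tensor_incl_injP := pD _ DN' => /(_ n m q mN' m0).
exact/vanish_in_mono/union_sub.
Qed.

Lemma pure_union : (forall N', D N' -> pure N') -> pure N.
Proof. by move=> pD A; apply: tensor_incl_inj_union => N' /pD; apply. Qed.

(** A tuple of the union lies in some member N', and the condition on N' (x) A
    brings the vanishing back from [M] to N'. *)
Lemma ML_union_incl (Q : lmodType R -> Prop) :
  (forall N', D N' -> mittag_leffler Q (submod N')) ->
  (forall N' A, D N' -> Q A -> tensor_incl_inj A N') ->
  mittag_leffler Q (submod N).
Proof.
move=> MLD injD; apply/mittag_leffler_submodP => I Qs QQs n m q mN q0.
have [N' DN' mN'] := union_finite mN.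
apply: (@vanish_in_mono N'); first exact: union_sub.
have /mittag_leffler_submodP := MLD _ DN'; apply=> // i.
have /tensor_incl_injP := injD _ _ DN' (QQs i); apply => //.
exact: vanish_in_top (q0 i).
Qed.

(** The vanishing over [N] of the components of a kernel element may be visible only
    in members of [D] that depend on the index. The point is that for each tuple one
    member suffices, as otherwise a countable chain of failures has a union in [D]
    that is not Mittag-Leffler. *)
Lemma flat_ML_union (Q : lmodType R -> Prop) :
  (forall N', D N' -> flat_ML Q (submod N')) ->
  closed_under_unions (@countable_chain R M) D -> flat_ML Q (submod N).
Proof.
move=> FD clD; have flN : flat (submod N) by apply: flat_union => N' /FD[].
split=> //.
have stable N0 n (m : 'I_n -> M) : D N0 -> (forall k, m k \in N0) ->
    exists2 N', D N' & forall A (q : 'I_n -> A), Q A ->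
      vanish_in N m q -> vanish_in N' m q.
  move=> DN0 mN0; apply: contrapT => noN'.
  pose X := {N' | D N' /\ {subset N0 <= N'}}.
  have /choice[f fP] (x : X) : exists y : X * {A : lmodType R & 'I_n -> A},
      [/\ {subset (sval x) <= sval y.1}, Q (projT1 y.2),
          vanish_in (sval y.1) m (projT2 y.2)
        & ~ vanish_in (sval x) m (projT2 y.2)].
    case: x => N1 [DN1 s01] /=; apply: contrapT => noy; apply: noN'.
    exists N1 => // A q QA qN; apply: contrapT => qN1; apply: noy.
    have [p [m' [B [m'N mE Bq]]]] := vanish_in_flat flN qN.
    have [N2 [DN2 s12 m'N2]] := union_finite_above DN1 m'N.
    have D02 : D N2 /\ {subset N0 <= N2} by split=> // x /s01/s12.
    exists (exist _ N2 D02, existT _ A q); split=> //=.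
    exact: vanish_in_kills m'N2 mE Bq.
  pose x := fix x j : X := if j is j'.+1 then (f (x j')).1
                           else exist _ N0 (conj DN0 (fun _ h => h)).
  pose A j := projT1 (f (x j)).2; pose q j : 'I_n -> A j := projT2 (f (x j)).2.
  have mono i j : (i <= j)%N -> {subset sval (x i) <= sval (x j)}.
    elim: j => [|j IH]; first by rewrite leqn0 => /eqP ->.
    rewrite leq_eqVlt => /orP[/eqP -> //|]; rewrite ltnS => /IH s y /s.
    by have [+ _ _ _] := fP (x j); apply.
  have [|||Nw DNw NwE] := clD (range (fun j => sval (x j))).
  - by move=> _ [j _ <-]; case: (x j) => ? [].
  - by exists (sval (x 0%N)), 0%N.
  - split; last exact: card_image_le.
    move=> _ _ [i _ <-] [j _ <-].
    by have [/mono|/ltnW/mono] := leqP i j; [left|right].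
  have sub_w j : {subset sval (x j) <= Nw}.
    move=> y yj; have : (\bigcup_(N' in range (fun j => sval (x j))) [set` N']) y.
      by exists (sval (x j)) => //; exists j.
    by rewrite -NwE.
  (* Each component vanishes at stage j + 1, hence over the union of the chain. *)
  have : vanish_in Nw m (fun k => (fun j => q j k) : prod_lmod A).
    have [_ /mittag_leffler_submodP] := FD _ DNw; apply.
    - by move=> j; have [_ + _ _] := fP (x j).
    - by move=> k; apply: (sub_w 0%N); exact: mN0.
    move=> j; apply: vanish_in_mono (sub_w j.+1) _.
    by have [_ _ + _] := fP (x j).
  have [flw _] := FD _ DNw.
  move=> /(vanish_in_flat flw)[p [m' [B [m'w mE Bq]]]].
  have [j m'j] : exists j, forall l, m' l \in sval (x j).
    have /choice[h hP] l : exists j, m' l \in sval (x j).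
      have : [set` Nw] (m' l) by exact: m'w.
      by rewrite NwE => -[_ [j _ <-] ?]; exists j.
    exists (\max_l h l)%N => l; apply: mono (hP l).
    exact: leq_bigmax.
  have [_ _ _] := fP (x j); apply; apply: (vanish_in_kills m'j mE).
  exact: kills_prod Bq j.
apply/mittag_leffler_submodP => I Qs QQs n m q mN q0.
have [N0 DN0 mN0] := union_finite mN.
have [N1 DN1 st] := stable _ _ _ DN0 mN0.
have [N2 [DN2 s02 mN2]] := union_finite_above DN1 mN.
apply: (@vanish_in_mono N2); first exact: union_sub.
have [_ /mittag_leffler_submodP] := FD _ DN2; apply=> // i.
exact: vanish_in_mono s02 (st _ _ (QQs i) (q0 i)).
Qed.

End DirectedUnion.
End Submodules.

(** * Stable factorizations *)

(** If not, each factorization x of [m] fails to kill some q_x with vanishing sum.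
    Test the Mittag-Leffler property on the family indexed by all the
    factorizations: by flatness a single factorization x kills the product of the
    q_x, in particular its own q_x. *)
Lemma ML_stable (R : pzRingType) (Q : lmodType R -> Prop) (M : lmodType R^c) :
  flat_ML Q M -> forall n (m : 'I_n -> M),
  exists p (m' : 'I_p -> M) (B : 'I_p -> 'I_n -> R), factors m m' B /\
    forall (A : lmodType R) (q : 'I_n -> A), Q A -> tsum m q = 0 -> kills B q.
Proof.
move=> [flM /mittag_lefflerP MLM] n m; apply: contrapT => noB.
pose X := {x : {p & (('I_p -> M) * ('I_p -> 'I_n -> R))%type} |
  factors m (projT2 x).1 (projT2 x).2}.
have /choice[f fP] (x : X) : exists y : {A : lmodType R & 'I_n -> A},
    [/\ Q (projT1 y), tsum m (projT2 y) = 0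
      & ~ kills (projT2 (sval x)).2 (projT2 y)].
  case: x => -[p [m' B]] /= mE; apply: contrapT => noy; apply: noB.
  exists p, m', B; split=> // A q QA q0; apply: contrapT => Bq; apply: noy.
  by exists (existT _ A q).
have : tsum m (fun k => (fun x => projT2 (f x) k) : prod_lmod (fun x => projT1 (f x))) = 0.
  by apply: MLM => x; have [] := fP x.
move=> /(flat_vanish flM)[p [m' [B [mE Bq]]]].
pose x : X := exist _ (existT _ p (m', B)) mE.
have [_ _] := fP x; apply.
exact: kills_prod Bq x.
Qed.

(** * Countable presentation of sequential colimits *)

Section SequentialColimit.
Variable S : pzRingType.

Record presentation (X : lmodType S) : Type := Presentation {
  gens : countType;
  rels : countType;
  relmap : {linear free_module S rels -> free_module S gens};
  genmap : {linear free_module S gens -> X};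
  genmap_surj : forall y, exists x, genmap x = y;
  genmap_ker : forall x, genmap x = 0 <-> exists y, relmap y = x
}.

Lemma presentation_of (X : lmodType S) : countably_presented X -> presentation X.
Proof.
by move=> /cid[I /cid[J /cid[g /cid[f [f_surj f_ker]]]]]; exact: Presentation f_surj f_ker.
Qed.

Variables (X : nat -> lmodType S) (N : lmodType S).
Variables (t : forall j, {linear X j -> X j.+1}) (h : forall j, {linear X j -> N}).
Hypothesis cpX : forall j, countably_presented (X j).
Hypothesis h_t : forall j x, h j.+1 (t j x) = h j x.
Hypothesis h_surj : forall y, exists j x, h j x = y.
Hypothesis h_ker : forall j x, h j x = 0 -> t j x = 0.

Let P j := presentation_of (cpX j).
Let I : countType := {j : nat & gens (P j)}.
Let J : countType := ({j : nat & rels (P j)} + {j : nat & gens (P j)})%type.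
Let f j := genmap (P j).

Let liftable (ji : I) : exists u,
  f (tag ji).+1 u = t (tag ji) (f (tag ji) (basis S (tagged ji))).
Proof. exact: genmap_surj. Qed.

(** A lift to the generators of stage j + 1 of the image of a generator of
    stage j. *)
Let u0 (ji : I) := projT1 (cid (liftable ji)).
Let u0P ji : f (tag ji).+1 (u0 ji) = t (tag ji) (f (tag ji) (basis S (tagged ji))).
Proof. by rewrite /u0; case: cid. Qed.

Let u j : {linear free_module S (gens (P j)) -> free_module S (gens (P j.+1))} :=
  free_lift (fun i : gens (P j) =>
    u0 (Tagged (fun j => gens (P j)) i) : free_module S (gens (P j.+1))).
Let io j : {linear free_module S (gens (P j)) -> free_module S I} :=
  free_lift (fun i : gens (P j) => basis S (Tagged (fun j => gens (P j)) i : I)).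
Let H : {linear free_module S I -> N} :=
  free_lift (fun ji : I => h (tag ji) (f (tag ji) (basis S (tagged ji)))).
Let G : {linear free_module S J -> free_module S I} :=
  free_lift (fun r : J => match r with
    | inl jb => io (tag jb) (relmap (P (tag jb)) (basis S (tagged jb)))
    | inr ji => basis S ji - io (tag ji).+1 (u0 ji) end).

Let uE j (i : gens (P j)) : u j (basis S i) = u0 (Tagged (fun j => gens (P j)) i).
Proof. exact: free_lift_basis. Qed.

Let ioE j (i : gens (P j)) : io j (basis S i) = basis S (Tagged (fun j => gens (P j)) i : I).
Proof. exact: free_lift_basis. Qed.

Let HE (i : I) : H (basis S i) = h (tag i) (f (tag i) (basis S (tagged i))).
Proof. exact: free_lift_basis. Qed.

Let GEl j (b : rels (P j)) :
  G (basis S (inl (Tagged (fun j => rels (P j)) b) : J)) = io j (relmap (P j) (basis S b)).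
Proof. exact: free_lift_basis. Qed.

Let GEr (i : I) :
  G (basis S (inr i : J)) = basis S i - io (tag i).+1 (u0 i).
Proof. exact: free_lift_basis. Qed.

Let fu j y : f j.+1 (u j y) = t j (f j y).
Proof.
move: y; apply: free_ind => [|a x y fx fy|i]; rewrite ?linear0 ?linearP ?fx ?fy //.
by rewrite uE (u0P (Tagged (fun j => gens (P j)) i)).
Qed.

Let Hio j y : H (io j y) = h j (f j y).
Proof.
move: y; apply: free_ind => [|a x y fx fy|i]; rewrite ?linear0 ?linearP ?fx ?fy //.
by rewrite ioE HE.
Qed.

Let imG x := exists w, G w = x.

Let imGP a x y : imG x -> imG y -> imG (a *: x + y).
Proof. by move=> [v <-] [w <-]; exists (a *: v + w); rewrite linearP. Qed.

Let imG0 : imG 0.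
Proof. by exists 0; rewrite linear0. Qed.

Let imG_rel j z : imG (io j (relmap (P j) z)).
Proof.
move: z; apply: free_ind => [|a x y Gx Gy|b]; rewrite ?linear0 ?linearP //; first exact: imGP.
exists (basis S (inl (Tagged (fun j => rels (P j)) b) : J)).
exact: GEl.
Qed.

(** Modulo the relations, elements of one stage may be replaced by their images in
    the next one. *)
Let imG_step j y : imG (io j y - io j.+1 (u j y)).
Proof.
move: y; apply: free_ind => [|a x y Gx Gy|i].
- by rewrite !linear0 addr0.
- by rewrite !linearP addrACA -scalerDr; exact: imGP.
exists (basis S (inr (Tagged (fun j => gens (P j)) i) : J)).
by rewrite GEr ioE uE.
Qed.

Let HG w : H (G w) = 0.
Proof.
move: w; apply: free_ind => [|a x y fx fy|[[j b]|[j i]]].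
- by rewrite !linear0.
- by rewrite !linearP fx fy scaler0 addr0.
- rewrite GEl Hio (_ : f j _ = 0) ?linear0 //.
  by apply/genmap_ker; exists (basis S b).
- by rewrite GEr linearB Hio u0P h_t HE subrr.
Qed.

Let reaches j x := exists y, imG (x - io j y).

Let reaches_step j x : reaches j x -> reaches j.+1 x.
Proof.
move=> [y xy]; exists (u j y).
rewrite -(subrK (io j y) x) -addrA -[x - _]scale1r.
exact: imGP.
Qed.

Let reaches_le i j x : (i <= j)%N -> reaches i x -> reaches j x.
Proof.
elim: j => [|j IH]; first by rewrite leqn0 => /eqP ->.
rewrite leq_eqVlt => /orP[/eqP -> //|]; rewrite ltnS => /IH H1 /H1.
exact: reaches_step.
Qed.

Let reaches_some x : exists j, reaches j x.
Proof.
move: x; apply: free_ind => [|a x y [j1 x1] [j2 y2]|[j i]].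
- by exists 0%N, 0; rewrite linear0 subr0.
- exists (maxn j1 j2).
  have [x' xx'] := reaches_le (leq_maxl j1 j2) x1.
  have [y' yy'] := reaches_le (leq_maxr j1 j2) y2.
  exists (a *: x' + y'); rewrite linearP opprD addrACA -scalerN -scalerDr.
  exact: imGP.
- by exists j, (basis S i); rewrite ioE subrr.
Qed.

(** Take the generators of all stages. The relations are those of all stages,
    together with the identification of each generator with a lift of its image in
    the next stage. A relation of [N] is pushed to a single stage modulo the
    identifications, and there [h_ker] makes it a relation of the next stage. *)
Lemma colim_countably_presented : countably_presented N.
Proof.
exists I, J, G, H; split=> [y|x].
  have [j [x <-]] := h_surj y; have [z <-] := genmap_surj (P j) x.
  by exists (io j z); rewrite Hio.
split=> [x0|[w <-]]; last exact: HG.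
have [j [y xy]] := reaches_some x.
suff yG : imG (io j y).
  by have := imGP 1 xy yG; rewrite scale1r subrK.
have [w wE] := xy.
have y0 : h j (f j y) = 0.
  by rewrite -Hio; have := HG w; rewrite wE linearB x0 sub0r => /eqP; rewrite oppr_eq0 => /eqP.
have /genmap_ker[z zE] : f j.+1 (u j y) = 0 by rewrite fu; exact: h_ker.
have := imGP 1 (imG_step y) (imG_rel z).
by rewrite zE scale1r subrK.
Qed.

End SequentialColimit.

(** * Countable chains and countably generated submodules *)

(** [x0] fills the indices that enumerate nothing, so that [A] may be empty. *)
Lemma countable_enum (T : Type) (A : set T) (x0 : T) : countable A ->
  exists e : nat -> T, (forall x, A x -> exists j, e j = x) /\
    forall j, A (e j) \/ e j = x0.
Proof.
move=> /countable_injP[f f_inj].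
have /choice[e eP] j : exists y, (A y /\ f y = j) \/
    ((forall x, A x -> f x <> j) /\ y = x0).
  have [[x [Ax fx]]|noy] := pselect (exists x, A x /\ f x = j).
    by exists x; left.
  by exists x0; right; split=> // x Ax fx; apply: noy; exists x.
exists e; split=> [x Ax|j]; last by case: (eP j) => -[? ?]; [left|right].
exists (f x); case: (eP (f x)) => [[Ae fe]|[/(_ x Ax)]//].
by apply: f_inj; rewrite ?inE.
Qed.

Section CountablyGenerated.
Variables (R : pzRingType) (M : lmodType R^c).

Lemma countably_presented_gens (N : submodClosed M) :
  countably_presented (submod N) ->
  exists G : set M, countable G /\
    forall N' : submodClosed M, G `<=` [set` N'] -> {subset N <= N'}.
Proof.
move=> [I [J [g [f [f_surj _]]]]].
exists (range (fun i : I => val (f (basis R^c i)))); split.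
  exact: sub_countable (card_image_le _ _) (countableP _).
move=> N' GN' x xN; have [z zE] := f_surj (Submod xN).
rewrite -[x]/(val (Submod xN)) -zE.
move: z {zE}; apply: free_ind => [|a y z yN zN|i].
- by rewrite linear0; exact: rpred0.
- by rewrite linearP; apply: rpredD zN; exact: rpredZ.
- by apply: GN'; exists i.
Qed.

Lemma countable_cover_directed (U : set (submodClosed M)) :
  (forall N, U N -> countably_presented (submod N)) ->
  (forall C : set M, countable C -> exists2 N, U N & C `<=` [set` N]) ->
  directed U.
Proof.
move=> cpU covU; split; first by have [N UN _] := covU _ (countable0 M); exists N.
move=> N1 N2 U1 U2.
have [G1 [cG1 G1N]] := countably_presented_gens (cpU _ U1).
have [G2 [cG2 G2N]] := countably_presented_gens (cpU _ U2).
have [|N UN GN] := covU (G1 `|` G2).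
  rewrite -bigcup2E; apply: bigcup_countable => [|[|[|i]] _] //=.
by exists N; split=> //; [apply: G1N|apply: G2N] => x Gx; apply: GN; [left|right].
Qed.

(** Run through an enumeration of the chain and keep the larger of two members. *)
Lemma countable_chain_cofinal (C : set (submodClosed M)) :
  C !=set0 -> countable_chain C -> exists x : nat -> submodClosed M,
  [/\ forall j, C (x j), forall j, {subset x j <= x j.+1}
    & forall N, C N -> exists j, {subset N <= x j}].
Proof.
move=> [N0 C0] [chC /(countable_enum N0)[e [e_surj eC]]].
have Ce j : C (e j) by case: (eC j) => [|->].
pose up (N N' : submodClosed M) : submodClosed M := if pselect ({subset N <= N'}) then N' else N.
pose x := fix x j := if j is j'.+1 then up (x j') (e j') else e 0%N.
have Cx j : C (x j).
  by elim: j => [|j IH] /=; [exact: Ce|rewrite /up; case: pselect => ?; [exact: Ce|]].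
have sub_l j : {subset x j <= x j.+1}.
  by rewrite /= /up; case: pselect => [s|?] y yx //; exact: s.
exists x; split=> // N /e_surj[j <-].
exists j.+1; rewrite /= /up; case: pselect => [?|nsub] y yN //.
by have [s|s] := chC _ _ (Cx j) (Ce j); [case: nsub|exact: s].
Qed.

Lemma countably_presented_union (C : set (submodClosed M)) (N : submodClosed M) :
  C !=set0 -> countable_chain C -> is_union C N ->
  (forall N', C N' -> countably_presented (submod N')) ->
  countably_presented (submod N).
Proof.
move=> C0 chC uN cpC; have [x [Cx s_x cof]] := countable_chain_cofinal C0 chC.
have s_N j : {subset x j <= N} by move=> y yx; apply/uN; exists (x j).
apply: (@colim_countably_presented _ (fun j => submod (x j)) (submod N)
  (fun j => submod_le (s_x j)) (fun j => submod_le (s_N j))).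
- by move=> j; exact: cpC.
- by move=> j y; exact: val_inj.
- move=> y; have /uN[N' CN' yN'] := valP y; have [j sj] := cof _ CN'.
  by exists j, (Submod (sj _ yN')); apply: val_inj.
- by move=> j y /(congr1 val) /= y0; apply: val_inj.
Qed.

End CountablyGenerated.

Lemma free_lift_ord (S : pzRingType) n (V : lmodType S) (g : 'I_n -> V) x :
  free_lift g x = \sum_k fcoef x k *: g k.
Proof.
rewrite (@free_liftE _ _ _ _ _ (enum 'I_n)) ?enum_uniq ?big_enum //.
by move=> k _; rewrite mem_enum.
Qed.

Lemma free_countably_presented (S : pzRingType) n :
  countably_presented (free_module S 'I_n).
Proof.
exists 'I_n, void, (free_lift (fun v : void => match v with end)), idfun.
split=> [y|x]; first by exists y.
split=> [/= ->|[y <-]]; first by exists 0; rewrite linear0.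
by rewrite /= (_ : y = 0) ?linear0 //; apply: fcoef_ext => -[].
Qed.

(** * The submodule generated by a tower of stable factorizations *)

Section Tower.
Variables (R : pzRingType) (Q : lmodType R -> Prop) (M : lmodType R^c).

(** The j-th step takes a stable factorization of the current tuple and adjoins the
    element [c j], on which the matrix has a zero row. *)
Lemma stable_tower (c : nat -> M) : flat_ML Q M ->
  exists (n : nat -> nat) (m : forall j, 'I_(n j) -> M)
    (B : forall j, 'I_(n j.+1) -> 'I_(n j) -> R),
    [/\ forall j, factors (m j) (m j.+1) (B j), forall j, exists k, m j.+1 k = c j
      & forall j (A : lmodType R) (q : 'I_(n j) -> A),
          Q A -> tsum (m j) q = 0 -> kills (B j) q].
Proof.
move=> FM; pose T := {p & 'I_p -> M}.
have step (s : T) (x : M) : exists y : {s' : T & 'I_(tag s') -> 'I_(tag s) -> R},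
    [/\ factors (tagged s) (tagged (tag y)) (tagged y),
        exists k, tagged (tag y) k = x
      & forall (A : lmodType R) (q : 'I_(tag s) -> A),
          Q A -> tsum (tagged s) q = 0 -> kills (tagged y) q].
  case: s => n m /=; have [p [m' [B [mE Bq]]]] := ML_stable FM m.
  pose m'' (k : 'I_p.+1) : M := oapp m' x (unlift ord0 k).
  pose B' (k : 'I_p.+1) (l : 'I_n) : R := oapp (B^~ l) 0 (unlift ord0 k).
  exists (existT (fun s' : T => 'I_(tag s') -> 'I_n -> R) (existT (fun p => 'I_p -> M) p.+1 m'') B').
  split=> /=.
  - move=> k; rewrite big_ord_recl /B' /m'' unlift_none /= scale0r add0r mE.
    by apply: eq_bigr => l _; rewrite liftK.
  - by exists ord0; rewrite /m'' unlift_none.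
  - move=> A q QA q0 l; rewrite /B'; case: unliftP => [l'|] _ /=; first exact: Bq.
    by rewrite big1 // => k _; rewrite scale0r.
pose nxt s x := projT1 (cid (step s x)).
pose s := fix s j : T := if j is j'.+1 then tag (nxt (s j') (c j'))
                         else existT (fun p => 'I_p -> M) 0%N (fun=> 0).
exists (fun j => tag (s j)), (fun j => tagged (s j)), (fun j => tagged (nxt (s j) (c j))).
by split=> j; have [] := projT2 (cid (step (s j) (c j))).
Qed.

Hypothesis QR : Q (R^o : lmodType R).

Variables (n : nat -> nat) (m : forall j, 'I_(n j) -> M).
Variable B : forall j, 'I_(n j.+1) -> 'I_(n j) -> R.
Arguments m : clear implicits.
Arguments B : clear implicits.
Hypothesis mB : forall j, factors (m j) (m j.+1) (B j).
Hypothesis B_kills : forall j (A : lmodType R) (q : 'I_(n j) -> A),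
  Q A -> tsum (m j) q = 0 -> kills (B j) q.

Definition tower_level j x := exists r : 'I_(n j) -> R, x = \sum_k (r k : R^c) *: m j k.

Let level_step j x : tower_level j x -> tower_level j.+1 x.
Proof.
move=> [r ->]; exists (fun l => \sum_k B j l k * r k).
under eq_bigr => k _ do rewrite mB scaler_sumr.
rewrite exchange_big; apply: eq_bigr => l _; rewrite (@scaler_suml R^c).
by apply: eq_bigr => k _; rewrite scalerA.
Qed.

Lemma tower_level_le i j x : (i <= j)%N -> tower_level i x -> tower_level j x.
Proof.
elim: j => [|j IH]; first by rewrite leqn0 => /eqP ->.
rewrite leq_eqVlt => /orP[/eqP -> //|]; rewrite ltnS => /IH H1 /H1.
exact: level_step.
Qed.

Variable N : submodClosed M.
Hypothesis NE : forall x, x \in N <-> exists j, tower_level j x.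

Let m_in j k : m j k \in N.
Proof.
apply/NE; exists j, (fun l => (l == k)%:R).
rewrite (bigD1 k) //= eqxx scale1r big1 ?addr0 // => l /negPf ->.
by rewrite scale0r.
Qed.

Let tuple_level p (y : 'I_p -> M) : (forall k, y k \in N) ->
  exists j (D : 'I_(n j) -> 'I_p -> R), factors y (m j) D.
Proof.
move=> yN; have /choice[h hP] k : exists j, tower_level j (y k) by apply/NE.
exists (\max_k h k)%N.
have /choice[D DP] k : tower_level (\max_k h k)%N (y k).
  by apply: tower_level_le (hP k); exact: leq_bigmax.
by exists (fun l k => D k l) => k; rewrite [LHS]DP.
Qed.

Let tuple_vanish p (y : 'I_p -> M) : (forall k, y k \in N) ->
  exists s (m' : 'I_s -> M) (D : 'I_s -> 'I_p -> R),
    [/\ forall l, m' l \in N, factors y m' D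
      & forall (A : lmodType R) (q : 'I_p -> A), Q A -> tsum y q = 0 -> kills D q].
Proof.
move=> /tuple_level[j [D yE]].
exists (n j.+1), (m j.+1), (matmul (B j) D); split.
- by move=> l; exact: m_in.
- exact: factors_trans yE (@mB j).
move=> A q QA q0; apply/kills_assoc/B_kills => //.
by rewrite -(tsum_factor _ yE).
Qed.

(** Here [R] in [Q] enters: a linear relation is a vanishing sum over [R^o], so it is
    killed one level higher. *)
Lemma tower_flat : flat (submod N).
Proof.
apply/equational_flat/equational_submodP => p y r yN r0.
have [s [m' [D [m'N yE Dq]]]] := tuple_vanish yN.
exists s, m', D; split=> //; apply: Dq => //.
by rewrite tsum_regular r0 tens0l.
Qed.

Lemma tower_incl_inj (A : lmodType R) : Q A -> tensor_incl_inj A N.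
Proof.
move=> QA; apply/tensor_incl_injP => p y q yN q0.
have [s [m' [D [m'N yE Dq]]]] := tuple_vanish yN.
exact: vanish_in_kills m'N yE (Dq _ _ QA q0).
Qed.

Lemma tower_ML : mittag_leffler Q (submod N).
Proof.
apply/mittag_leffler_submodP => I Qs QQs p y q yN q0.
have [s [m' [D [m'N yE Dq]]]] := tuple_vanish yN.
apply: (vanish_in_kills m'N yE) => l; apply: functional_extensionality_dep => i.
rewrite -[LHS]/(@prod_proj R I Qs i _) linear_sum.
rewrite -[RHS](Dq _ _ (QQs i) (vanish_in_top (q0 i)) l).
by apply: eq_bigr => k _; rewrite linearZ.
Qed.

(** [N] is the colimit of the free modules on the tuples [m j]: by [QR], an element
    of level j that becomes zero in [M] is annihilated by [B j]. *)
Lemma tower_countably_presented : countably_presented (submod N).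
Proof.
pose t j : {linear free_module R^c 'I_(n j) -> free_module R^c 'I_(n j.+1)} :=
  free_lift (fun k => \sum_l (B j l k : R^c) *: basis R^c l).
pose h j : {linear free_module R^c 'I_(n j) -> submod N} :=
  free_lift (fun k : 'I_(n j) => Submod (m_in k)).
have hE j x : val (h j x) = \sum_k fcoef x k *: m j k.
  by rewrite /h /= free_lift_ord val_comb.
have hB j k : h j (basis R^c k) = Submod (m_in k) by exact: free_lift_basis.
apply: (@colim_countably_presented _ _ (submod N) t h).
- by move=> j; exact: free_countably_presented.
- move=> j x; move: x; apply: free_ind => [|a x y hx hy|k].
  + by rewrite !linear0.
  + by rewrite !linearP hx hy.
  + rewrite /t /h /= !free_lift_basis linear_sum; apply: val_inj => /=.
    rewrite [RHS]mB -[LHS]/(val _).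
    under eq_bigr => l _ do rewrite linearZ /= free_lift_basis.
    by rewrite /= val_comb.
- move=> y; have /NE[j [r yE]] := valP y.
  exists j, (\sum_k (r k : R^c) *: basis R^c k).
  have -> : h j (\sum_k (r k : R^c) *: basis R^c k) = \sum_k (r k : R^c) *: h j (basis R^c k).
    by rewrite linear_sum; apply: eq_bigr => k _; rewrite linearZ.
  apply: val_inj; rewrite /= val_comb [RHS]yE.
  by apply: eq_bigr => k _; rewrite -[free_lift _ _]/(h j _) hB.
- move=> j x /(congr1 val); rewrite hE /= => x0.
  have : tsum (m j) ((fun k => fcoef x k) : 'I_(n j) -> R^o) = 0.
    by rewrite tsum_regular x0 tens0l.
  move=> /(B_kills QR) Bx; rewrite /t /= free_lift_ord.
  under eq_bigr => k _ do rewrite scaler_sumr.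
  rewrite exchange_big big1 // => l _.
  under eq_bigr => k _ do rewrite scalerA.
  rewrite -(@scaler_suml R^c).
  have -> : \sum_k (fcoef x k * (B j l k : R^c) : R^c) = 0 :> R^c by exact: Bx.
  by rewrite scale0r.
Qed.

End Tower.

(** * Squares of infinite cardinals *)

Section Comparability.
Variables (T U : Type) (A : set T) (B : set U).

Let pinj (G : set (T * U)) :=
  [/\ forall x y, G (x, y) -> A x /\ B y,
      forall x y y', G (x, y) -> G (x, y') -> y = y'
    & forall x x' y, G (x, y) -> G (x', y) -> x = x'].

(** A maximal graph of a partial injection is total or onto. The injection is given
    by its graph so that no default value is required in [T] or [U]. *)
Lemma card_comparable :
  (exists G : T -> U -> Prop, (forall x, A x -> exists2 y, B y & G x y) /\
     forall x x' y, G x y -> G x' y -> x = x') \/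
  (exists G : U -> T -> Prop, (forall y, B y -> exists2 x, A x & G y x) /\
     forall y y' x, G y x -> G y' x -> y = y').
Proof.
have [|G [[GAB Gf Gi] Gmax]] := @Zorn_bigcup _ pinj.
  move=> F FP chF; have two p p' : (\bigcup_(X in F) X) p -> (\bigcup_(X in F) X) p' ->
      exists X, [/\ F X, X p & X p'].
    move=> [X FX Xp] [Y FY Yp]; have [s|s] := chF _ _ FX FY.
      by exists Y; split=> //; apply: s.
    by exists X; split=> //; apply: s.
  split.
  - by move=> x y [X /FP[XAB _ _] /XAB].
  - move=> x y y' Gy Gy'; have [X [/FP[_ Xf _] Xy Xy']] := two _ _ Gy Gy'.
    exact: Xf Xy Xy'.
  - move=> x x' y Gy Gy'; have [X [/FP[_ _ Xi] Xy Xy']] := two _ _ Gy Gy'.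
    exact: Xi Xy Xy'.
have [domA|ndomA] := pselect (forall x, A x -> exists y, G (x, y)).
  left; exists (fun x y => G (x, y)); split=> [x /domA[y Gxy]|]; last exact: Gi.
  by exists y => //; have [] := GAB _ _ Gxy.
have [ranB|nranB] := pselect (forall y, B y -> exists x, G (x, y)).
  right; exists (fun y x => G (x, y)); split=> [y /ranB[x Gxy]|].
    by exists x => //; have [] := GAB _ _ Gxy.
  by move=> y y' x; exact: Gf.
move: ndomA => /existsNP[a /not_implyP[Aa /forallNP nGa]].
move: nranB => /existsNP[b /not_implyP[Bb /forallNP nGb]].
case: (Gmax (G `|` [set (a, b)])).
  split; first by left.
  by move=> /(_ (a, b)) s; apply: (nGa b); apply: s; right.
split.
- by move=> x y [/GAB|[-> ->]].
- move=> x y y' [Gxy|[-> ->]] [Gxy'|[]].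
  + exact: Gf Gxy Gxy'.
  + by move=> xa; rewrite xa in Gxy; case: (nGa _ Gxy).
  + by case: (nGa _ Gxy').
  + by move=> ->.
- move=> x x' y [Gxy|[-> ->]] [Gxy'|[]].
  + exact: Gi Gxy Gxy'.
  + by move=> _ yb; rewrite yb in Gxy; case: (nGb _ Gxy).
  + by case: (nGb _ Gxy').
  + by move=> ->.
Qed.

End Comparability.

Section Square.
Variables (K : Type) (i : nat -> K).
Hypothesis i_inj : injective i.

(** Graphs of injections from [A] x [A] to [A]; the set [A] is determined by [G], as
    the projection of its domain. Graphs make chains easy to unite. *)
Definition square_graph (A : set K) (G : set ((K * K) * K)) :=
  [/\ forall x y z, G ((x, y), z) -> [/\ A x, A y & A z],
      forall x y, A x -> A y -> exists z, G ((x, y), z),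
      forall p z z', G (p, z) -> G (p, z') -> z = z'
    & forall p p' z, G (p, z) -> G (p', z) -> p = p'].

(** Zorn's lemma, above the graph of a pairing function on the copy [i] of the
    natural numbers, so that the maximal [A] is infinite. *)
Lemma square_maximal : exists A G, [/\ square_graph A G, forall j, A (i j)
  & forall A' G', square_graph A' G' -> G `<=` G' -> A `<=` A' -> A' `<=` A].
Proof.
have /countable_injP[c c_inj] : countable [set: nat * nat] by exact: countableP.
pose A0 := range i.
pose G0 : set ((K * K) * K) := range (fun p : nat * nat => ((i p.1, i p.2), i (c p))).
have sq0 : square_graph A0 G0.
  split.
  - by move=> x y z [[j k] _ [<- <- <-]]; split; [exists j|exists k|exists (c (j, k))].
  - by move=> _ _ [j _ <-] [k _ <-]; exists (i (c (j, k))); exists (j, k).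
  - by move=> p z z' [[j k] _ [<- <-]] [[j' k'] _ [/i_inj -> /i_inj -> <-]].
  - move=> p p' z [q _ [<- <-]] [q' _ [<- /i_inj/c_inj]].
    by rewrite !inE => ->.
pose P G := exists A, square_graph A (G0 `|` G).
have [|G [[A sqA] Gmax]] := @Zorn_bigcup _ P.
  move=> F FP chF; pose A := [set x | exists X B, [/\ F X \/ X = set0, square_graph B (G0 `|` X) & B x]].
  have sq_0 : square_graph A0 (G0 `|` set0) by rewrite setU0.
  have dir X Y : F X \/ X = set0 -> F Y \/ Y = set0 ->
      exists Z, [/\ F Z \/ Z = set0, X `<=` Z & Y `<=` Z].
    move=> [FX|->] [FY|->]; [|by exists X; split=> //; left|by exists Y; split=> //; left|].
      by have [s|s] := chF _ _ FX FY; [exists Y|exists X]; split=> //; left.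
    by exists set0; split=> //; right.
  have sub_sq X Y B B' x : X `<=` Y -> square_graph B (G0 `|` X) ->
      square_graph B' (G0 `|` Y) -> B x -> B' x.
    move=> sXY [_ B2 _ _] [B1 _ _ _] Bx; have [z Gz] := B2 _ _ Bx Bx.
    have [|] // := B1 x x z; by case: Gz => [|/sXY]; [left|right].
  have ofX X : F X \/ X = set0 -> exists B, square_graph B (G0 `|` X).
    by move=> [/FP //|->]; exists A0.
  have memG p : (G0 `|` \bigcup_(X in F) X) p <->
      exists2 X, F X \/ X = set0 & (G0 `|` X) p.
    split=> [[G0p|[X FX Xp]]|[X [FX|->]]].
    - by exists set0; [right|left].
    - by exists X; [left|right].
    - by case=> [|Xp]; [left|right; exists X].
    - by rewrite setU0; left.
  exists A; split.
  - move=> x y z /memG[X FX Xp]; have [B sqB] := ofX X FX.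
    have [B1 _ _ _] := sqB; have [Bx By Bz] := B1 _ _ _ Xp.
    by split; exists X, B.
  - move=> x y [X [B [FX sqB Bx]]] [Y [C [FY sqC Cy]]].
    have [Z [FZ sXZ sYZ]] := dir _ _ FX FY; have [D sqD] := ofX Z FZ.
    have [_ D2 _ _] := sqD.
    have [||z Gz] := D2 x y; [exact: sub_sq sXZ sqB sqD Bx|exact: sub_sq sYZ sqC sqD Cy|].
    by exists z; apply/memG; exists Z.
  - move=> p z z' /memG[X FX Xp] /memG[Y FY Yp].
    have [Z [FZ sXZ sYZ]] := dir _ _ FX FY; have [D [_ _ Df _]] := ofX Z FZ.
    exact: Df (setUS sXZ Xp) (setUS sYZ Yp).
  - move=> p p' z /memG[X FX Xp] /memG[Y FY Yp].
    have [Z [FZ sXZ sYZ]] := dir _ _ FX FY; have [D [_ _ _ Di]] := ofX Z FZ.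
    exact: Di (setUS sXZ Xp) (setUS sYZ Yp).
exists A, (G0 `|` G); split=> //.
  move=> j; have [A1 _ _ _] := sqA.
  have [|//] := A1 (i j) (i j) (i (c (j, j))); left; by exists (j, j).
move=> A' G' sqA' sG sA x A'x; apply: contrapT => nAx.
apply: (Gmax G'); last by exists A'; rewrite setUidr // => p G0p; apply: sG; left.
split; first by move=> p Gp; apply: sG; right.
move=> sG'; have [_ A2 _ _] := sqA'; have [z G'z] := A2 _ _ A'x A'x.
have [A1 _ _ _] := sqA; have [|//] := A1 x x z; right; exact: sG'.
Qed.

(** Take a maximal [A] with an injection [f] from A x A to A. If the complement of
    [A] embeds in [A], the whole of [K] embeds in two copies of [A], hence in [A]
    through [f]. Otherwise the complement contains a copy [B] of [A], and [f]
    extends to the union of both by sending the new pairs into [B], against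
    maximality. *)
Lemma infinite_square : exists p : K * K -> K, injective p.
Proof.
have [A [G [[A1 A2 Gf Gi] Ai Amax]]] := square_maximal.
have /choice[f0 f0P] (p : K * K) : exists z, A p.1 -> A p.2 -> G (p, z).
  case: p => x y /=; have [Ax|] := pselect (A x); last by exists (i 0%N).
  have [Ay|] := pselect (A y); last by exists (i 0%N).
  by have [z Gz] := A2 _ _ Ax Ay; exists z.
pose f x y := f0 (x, y).
have fG x y : A x -> A y -> G ((x, y), f x y) by move=> Ax Ay; exact: f0P.
have fA x y : A x -> A y -> A (f x y) by move=> Ax Ay; have [] := A1 _ _ _ (fG _ _ Ax Ay).
have f_inj x y x' y' : A x -> A y -> A x' -> A y' -> f x y = f x' y' ->
    x = x' /\ y = y'.
  move=> Ax Ay Ax' Ay' e.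
  have Ge : G ((x', y'), f x y) by rewrite e; exact: fG.
  by case: (Gi _ _ _ (fG _ _ Ax Ay) Ge).
(* When the complement embeds in A, the second argument of [f] records on which
   side x lies. *)
have [[H [HAB Hi]]|[H [HBA Hi]]] := card_comparable A (~` A); last first.
  have /choice[g gP] x : exists y, ~ A x -> A y /\ H x y.
    have [Ax|nAx] := pselect (A x); first by exists x.
    by have [y Ay Hy] := HBA _ nAx; exists y.
  pose io x := if pselect (A x) then f x (i 0%N) else f (g x) (i 1%N).
  have ioA x : A (io x).
    rewrite /io; case: pselect => [Ax|nAx]; first exact: fA.
    by apply: fA => //; have [] := gP _ nAx.
  have io_inj : injective io.
    move=> x y; rewrite /io; case: pselect => [Ax|nAx]; case: pselect => [Ay|nAy].
    - by case/f_inj.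
    - by have [? _] := gP _ nAy; case/f_inj => // _ /i_inj.
    - by have [? _] := gP _ nAx; case/f_inj => // _ /i_inj.
    - have [? Hx] := gP _ nAx; have [? Hy] := gP _ nAy.
      by case/f_inj => // e _; apply: Hi Hx _; rewrite e.
  exists (fun p => f (io p.1) (io p.2)) => -[x y] [x' y'] /=.
  by case/f_inj => // /io_inj -> /io_inj ->.
have /choice[b bP] x : exists y, A x -> ~ A y /\ H x y.
  have [Ax|nAx] := pselect (A x); last by exists x.
  by have [y Ay Hy] := HAB _ Ax; exists y.
have b_inj x y : A x -> A y -> b x = b y -> x = y.
  move=> Ax Ay e; have [_ Hx] := bP _ Ax; have [_ Hy] := bP _ Ay.
  by apply: Hi Hx _; rewrite e.
pose B := [set b x | x in A]; pose A' := A `|` B.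
have /choice[r rP] x : exists y, A' x -> A y /\ (x = if pselect (A x) then y else b y).
  have [Ax|nAx] := pselect (A x); first by exists x => _; case: pselect.
  have [[y Ay <-]|nB] := pselect (B x).
    by exists y => _; split=> //; case: pselect => // Ab; case: (bP _ Ay).
  by exists x => -[].
pose tau x : nat := if pselect (A x) then 0%N else 1%N.
have rA x : A' x -> A (r x) by move=> /rP[].
have r_inj x y : A' x -> A' y -> r x = r y -> tau x = tau y -> x = y.
  move=> A'x A'y; have [_ xE] := rP _ A'x; have [_ yE] := rP _ A'y.
  move: xE yE; rewrite /tau; case: pselect => ?; case: pselect => ? //= xE yE rxy _.
    by rewrite xE yE rxy.
  by rewrite xE yE rxy.
(* The four values of [tau x + 2 tau y] tell apart the four kinds of pairs over the
   union of A and its copy B; pairs in A x A have value 0 and keep their image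
   under [f]. *)
pose code x y := f (f (r x) (r y)) (i (tau x + (tau y).*2)%N).
have codeA x y : A' x -> A' y -> A (code x y).
  by move=> A'x A'y; apply: (fA) => //; apply: fA; exact: rA.
have code_inj x y x' y' : A' x -> A' y -> A' x' -> A' y' -> code x y = code x' y' ->
    x = x' /\ y = y'.
  move=> A'x A'y A'x' A'y' e.
  have Afr u v : A' u -> A' v -> A (f (r u) (r v)) by move=> A'u A'v; apply: fA; exact: rA.
  have [er /i_inj t] := f_inj _ _ _ _ (Afr _ _ A'x A'y) (Ai _) (Afr _ _ A'x' A'y') (Ai _) e.
  have [rx ry] := f_inj _ _ _ _ (rA _ A'x) (rA _ A'y) (rA _ A'x') (rA _ A'y') er.
  by split; apply: r_inj => //; move: t; rewrite /tau; do 4! case: pselect => ?.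
pose G' : set ((K * K) * K) := [set w | [/\ A' w.1.1, A' w.1.2 &
  w.2 = if pselect (A w.1.1 /\ A w.1.2) then f w.1.1 w.1.2 else b (code w.1.1 w.1.2)]].
have sq' : square_graph A' G'.
  split.
  - move=> x y z [/= A'x A'y ->]; split=> //; case: pselect => [[Ax Ay]|?].
      by left; exact: fA.
    by right; exists (code x y) => //; exact: codeA.
  - by move=> x y A'x A'y; eexists; split=> /=; [exact: A'x|exact: A'y|reflexivity].
  - by move=> p z z' [_ _ /= ->] [_ _ /= ->].
  - move=> [x y] [x' y'] z [/= A'x A'y ->] [/= A'x' A'y'].
    case: pselect => [[Ax Ay]|?]; case: pselect => [[Ax' Ay']|?] /=.
    + by case/f_inj => // -> ->.
    + have [nb _] := bP _ (codeA _ _ A'x' A'y') => e; case: nb; rewrite -e; exact: fA.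
    + have [nb _] := bP _ (codeA _ _ A'x A'y) => e; case: nb; rewrite e; exact: fA.
    + by move/b_inj => /(_ (codeA _ _ A'x A'y) (codeA _ _ A'x' A'y')) /code_inj[] // -> ->.
have [nb0 _] := bP _ (Ai 0%N); case: nb0.
apply: (Amax A' G') => //.
- move=> [[x y] z] Gz; have [Ax Ay _] := A1 _ _ _ Gz.
  split; rewrite /=; [by left|by left|case: pselect => [?|[]//]].
  exact: Gf Gz (fG _ _ Ax Ay).
- by move=> x Ax; left.
- by right; exists (i 0%N).
Qed.

(** The length is stored along with the iterated pair; so the encoding need not tell
    the empty list from a pair. *)
Lemma infinite_seq : exists e : seq K -> K, injective e.
Proof.
have [p p_inj] := infinite_square.
pose e := fix e (s : seq K) := if s is x :: s' then p (x, e s') else i 0%N.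
have e_inj s s' : size s = size s' -> e s = e s' -> s = s'.
  elim: s s' => [|x s IH] [|y s'] //= [/IH{}IH] /p_inj[-> /IH ->] //.
exists (fun s => p (i (size s), e s)) => s s' /p_inj[/i_inj]; exact: e_inj.
Qed.

End Square.

(** * Small pure submodules *)

Lemma card_le_injP (T U : Type) (u : U) (A : set T) :
  card_le A [set: U] <-> exists f : T -> U, {in A &, injective f}.
Proof.
elim/Ppointed: U => U in u *; first by have := @no U u.
split; first by move/pcard_injP.
by move=> ?; apply/pcard_injP.
Qed.

Lemma range_card_le (T U : Type) (f : T -> U) (A : set U) :
  A `<=` range f -> card_le A [set: T].
Proof.
by move=> Af; apply: card_le_trans (subset_card_le Af) (card_image_le _ _).
Qed.

Lemma injective_retract (T U : Type) (t : T) (f : T -> U) : injective f ->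
  exists g : U -> T, cancel f g.
Proof.
move=> f_inj; have /choice[g gP] u : exists x, forall y, f y = u -> y = x.
  have [[x xu]|nx] := pselect (exists x, f x = u).
    by exists x => y; rewrite -xu => /f_inj.
  by exists t => y yu; case: nx; exists y.
by exists g => x; rewrite [RHS](gP (f x) x erefl).
Qed.

Section LowenheimSkolem.
Variables (R : pzRingType) (M : lmodType R^c).
Local Notation K := (kappa R).

Let kn (j : nat) : K := inr j.
Let kr (r : R) : K := inl r.

Let kn_inj : injective kn. Proof. by move=> ? ? []. Qed.
Let kr_inj : injective kr. Proof. by move=> ? ? []. Qed.

Lemma kappa_pairs : exists p : K * K -> K, injective p.
Proof. exact: infinite_square kn_inj. Qed.

(** Arguments of one closure step: indices of elements found so far, coefficients of
    a linear combination of them, the matrix of a system, its number of unknowns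
    and the unknown to be returned. *)
Definition code : Type := (seq K * seq R * seq (seq R) * (nat * nat))%type.

Lemma kappa_codes : exists d : K -> code, forall w, exists k, d k = w.
Proof.
have [p p_inj] := kappa_pairs; have [e e_inj] := infinite_seq kn_inj.
pose c (w : code) : K := let: (ks, a, b, (n, l)) := w in
  p (e ks, p (e (map kr a), p (e (map (fun s => e (map kr s)) b), p (kn n, kn l)))).
have c_inj : injective c.
  move=> [[[ks a] b] [n l]] [[[ks' a'] b'] [n' l']] /=.
  case/p_inj => /e_inj -> /p_inj[/e_inj/inj_map-> //] /p_inj[/e_inj eb].
  move=> /p_inj[-> ->]; congr (_, _, _, _).
  by apply: inj_map eb => s s' /e_inj/inj_map; apply.
have [d dK] := injective_retract ([::], [::], [::], (0%N, 0%N)) c_inj.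
by exists d => w; exists (c w).
Qed.

Definition entry (b : seq (seq R)) l k : R := nth 0 (nth [::] b l) k.

Let solves (xs : seq M) b p (m' : nat -> M) :=
  forall k, (k < size xs)%N -> nth 0 xs k = \sum_(l < p) (entry b l k : R^c) *: m' l.

Let sol_exists xs b p : exists m', forall m0, solves xs b p m0 -> solves xs b p m'.
Proof.
have [[m0 s0]|ns] := pselect (exists m0, solves xs b p m0); first by exists m0.
by exists (fun=> 0) => m0 s0; case: ns; exists m0.
Qed.

(** A choice of solution of the system xs = m' b with [p] unknowns, if there is
    one. *)
Let sol xs b p := projT1 (cid (sol_exists xs b p)).

Let solP xs b p m0 : solves xs b p m0 -> solves xs b p (sol xs b p).
Proof. by rewrite /sol; case: cid => m' /= H; exact: H. Qed.

Let op (xs : seq M) (a : seq R) b p l : M :=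
  (\sum_(k < size xs) (nth 0 a k : R^c) *: nth 0 xs k) + (if (l < p)%N then sol xs b p l else 0).

(** Over a flat module this amounts to purity; the stage by stage closure below can
    enforce it because each system is a finite piece of data. *)
Definition solution_closed (N : submodClosed M) :=
  forall n p (m : 'I_n -> M) (m' : 'I_p -> M) B, (forall k, m k \in N) ->
    factors m m' B -> exists2 m'' : 'I_p -> M, forall l, m'' l \in N & factors m m'' B.

(** Stage i + 1 consists of the values of all operations at tuples of stage i; it is
    enumerated by [kappa R] as there are only kappa codes. *)
Lemma solution_closure (C : set M) : card_le_kappa R C ->
  exists N : submodClosed M,
    [/\ solution_closed N, C `<=` [set` N] & card_le_kappa R [set` N]].
Proof.
move=> /(card_le_injP (kn 0%N))[f f_inj].
have /choice[e0 e0P] k : exists y, forall x, C x -> f x = k -> x = y.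
  have [[x [Cx xk]]|nx] := pselect (exists x, C x /\ f x = k).
    by exists x => y Cy yk; apply: f_inj; rewrite ?inE // yk.
  by exists 0 => x Cx xk; case: nx; exists x.
have [d d_surj] := kappa_codes.
pose E := fix E (i : nat) : K -> M := if i is i'.+1
  then fun k => let: (ks, a, b, (p, l)) := d k in op (map (E i') ks) a b p l
  else e0.
have ES i ks a b p l : exists k, E i.+1 k = op (map (E i) ks) a b p l.
  by have [k dk] := d_surj (ks, a, b, (p, l)); exists k; rewrite /= dk.
(* With coefficient list [1] and no unknown, the operation returns its argument. *)
have Emono i j : (i <= j)%N -> forall k, exists k', E j k' = E i k.
  elim: j => [|j IH]; first by rewrite leqn0 => /eqP -> k; exists k.
  rewrite leq_eqVlt => /orP[/eqP -> k|]; first by exists k.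
  rewrite ltnS => /IH H k; have [k' <-] := H k.
  have [k'' Ek] := ES j [:: k'] [:: 1] [::] 0%N 0%N; exists k''.
  by rewrite Ek /op /= big_ord1 /= scale1r addr0.
have [||N NE] := @submod_from _ M (fun x => exists i k, E i k = x).
- exists 1%N; have [k Ek] := ES 0%N [::] [::] [::] 0%N 0%N; exists k; rewrite Ek.
  by rewrite /op /= big_ord0 addr0.
- move=> a x y [i1 [k1 x1]] [i2 [k2 y2]].
  have [k1' xE] := Emono _ _ (leq_maxl i1 i2) k1.
  have [k2' yE] := Emono _ _ (leq_maxr i1 i2) k2.
  exists (maxn i1 i2).+1.
  have [k Ek] := ES (maxn i1 i2) [:: k1'; k2'] [:: a; 1] [::] 0%N 0%N; exists k.
  rewrite Ek /op /= addr0 !big_ord_recl big_ord0 /= addr0 scale1r.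
  by rewrite xE yE x1 y2.
exists N; split.
- move=> n p m m' B mN mE.
  have /choice[h hP] k : exists i, exists k', E i k' = m k by apply/NE.
  pose i := \max_k h k.
  have /choice[g gP] k : exists k', E i k' = m k.
    have [k' <-] := hP k; apply: Emono; exact: leq_bigmax.
  pose b := [seq [seq B l k | k <- enum 'I_n] | l <- enum 'I_p].
  have bE (l : 'I_p) (k : 'I_n) : entry b l k = B l k.
    rewrite /entry (nth_map l) ?size_enum_ord // nth_ord_enum.
    by rewrite (nth_map k) ?size_enum_ord // nth_ord_enum.
  pose xs := [seq E i k | k <- map g (enum 'I_n)].
  have xsE (k : 'I_n) : nth 0 xs k = m k.
    rewrite /xs -map_comp (nth_map k) ?size_enum_ord // nth_ord_enum.
    exact: gP.
  have sz : size xs = n by rewrite 2!size_map size_enum_ord.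
  pose m0 (l : nat) : M := oapp m' 0 (insub l).
  have s0 : solves xs b p m0.
    move=> k; rewrite sz => ltkn; rewrite (xsE (Ordinal ltkn)) mE.
    by apply: eq_bigr => l _; rewrite /m0 valK /= -bE.
  exists (fun l => sol xs b p l).
    move=> l; apply/NE; exists i.+1.
    have [k Ek] := ES i (map g (enum 'I_n)) [::] b p l; exists k.
    rewrite Ek /op -/xs ltn_ord big1 ?add0r // => j _.
    by rewrite nth_nil scale0r.
  move=> k; rewrite -xsE (solP s0) ?sz //.
  by apply: eq_bigr => l _; rewrite bE.
- by move=> x Cx; apply/NE; exists 0%N, (f x); rewrite /= -(e0P (f x) x).
have [p p_inj] := kappa_pairs.
have [q qK] := injective_retract (kn 0%N, kn 0%N) p_inj.
pose num (k : K) : nat := if k is inr i then i else 0%N.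
apply: (@range_card_le _ _ (fun k => E (num (q k).1) (q k).2)).
move=> x /= /NE[i [k <-]]; exists (p (kn i, k)) => //.
by rewrite qK.
Qed.

Lemma solution_closed_pure (N : submodClosed M) :
  flat M -> solution_closed N -> pure N.
Proof.
move=> flM clN A; apply/tensor_incl_injP => n m q mN /(flat_vanish flM).
move=> [p [m' [B [mE Bq]]]]; have [m'' m''N mE'] := clN _ _ _ _ _ mN mE.
exact: vanish_in_kills m''N mE' Bq.
Qed.

(** An element of the union is determined by the position in the well-order of a
    member containing it and by its position in that member. Members are equal as
    sets when their positions are equal, hence an enumeration [c] may be chosen for
    each position. *)
Lemma card_chain_union (C : set (submodClosed M)) (N : submodClosed M) :
  submod_chain C -> length_le K C -> is_union C N ->
  (forall N', C N' -> card_le_kappa R [set` N']) -> card_le_kappa R [set` N].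
Proof.
move=> chC lenC uN cardC.
pose KE : eqType := (R + nat)%type.
have [r wo_r] := well_ordering_principle KE.
have [h hP] := lenC r wo_r.
have r_refl (k : KE) : r k k.
  have [|z [[zk zr] _]] := wo_r (pred1 k); first by exists k; rewrite inE.
  by move: zk (zr k); rewrite !inE => /eqP -> ->.
have hE N1 N2 : C N1 -> C N2 -> h N1 = h N2 -> {subset N1 <= N2}.
  by move=> C1 C2 e; apply/(hP _ _ C1 C2); rewrite e; exact: r_refl.
have /choice[c cP] (k : K) : exists e : K -> M, forall N', C N' -> h N' = k ->
    [set` N'] `<=` range e.
  have [[N0 [C0 k0]]|nN] := pselect (exists N0, C N0 /\ h N0 = k); last first.
    by exists (fun=> 0) => N' CN' kN'; case: nN; exists N'.
  have /(card_le_injP (kn 0%N))[f f_inj] := cardC _ C0.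
  have /choice[e eP] j : exists y, forall x, x \in N0 -> f x = j -> x = y.
    have [[x [Nx xj]]|nx] := pselect (exists x, x \in N0 /\ f x = j).
      by exists x => y Ny yj; apply: f_inj; rewrite ?inE // yj.
    by exists 0 => x Nx xj; case: nx; exists x.
  exists e => N' CN' kN' x xN'.
  exists (f x) => //; rewrite -(eP (f x) x) //.
  by apply: (hE N' N0) => //; rewrite kN'.
have [p p_inj] := kappa_pairs.
have [q qK] := injective_retract (kn 0%N, kn 0%N) p_inj.
apply: (@range_card_le _ _ (fun k => c (q k).1 (q k).2)).
move=> x /= /uN[N' CN' xN'].
have [k _ <-] := cP (h N') N' CN' erefl x xN'.
by exists (p (h N', k)); rewrite // qK.
Qed.

End LowenheimSkolem.

(** * The equivalences *)

Section Conditions.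
Variables (R : pzRingType) (M : lmodType R^c) (Q : lmodType R -> Prop).

Lemma is_union_set (C : set (submodClosed M)) (N : submodClosed M) :
  is_union C N -> [set` N] = \bigcup_(N' in C) [set` N'].
Proof.
move=> uN; apply/seteqP; split=> x /=; first by move=> /uN[N' CN' xN']; exists N'.
by move=> [N' CN' xN']; apply/uN; exists N'.
Qed.

(** A kernel element involves only a finite tuple [m], and purity of [N] brings the
    hypothesis and the conclusion from [M] to [N] and back. *)
Lemma flat_ML_locally :
  (forall n (m : 'I_n -> M), exists N : submodClosed M,
    [/\ pure N, flat_ML Q (submod N) & forall k, m k \in N]) -> flat_ML Q M.
Proof.
move=> loc; split.
  move=> A B g g_inj; apply/tensor_map_inj => n m q q0.
  have [N [pN [flN _] mN]] := loc n m; apply: (@vanish_in_top _ _ N).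
  exists (fun k => Submod (mN k)) => //.
  have /tensor_map_inj := flN _ _ g g_inj; apply.
  have mq0 : vanish_in N m (g \o q) by apply: (tensor_incl_injP N B).1.
  exact: (@vanish_inE _ _ N B _ (fun k => Submod (mN k)) (g \o q) mq0).
apply/mittag_lefflerP => I Qs QQs n m q q0.
have [N [pN [_ MLN] mN]] := loc n m; apply: (@vanish_in_top _ _ N).
have /mittag_leffler_submodP := MLN; apply=> // i.
by have /tensor_incl_injP := pN (Qs i); apply.
Qed.

Lemma small_range n (m : 'I_n -> M) : card_le_kappa R (range m).
Proof.
apply: card_le_trans (card_image_le _ _) _.
by apply/(card_le_injP (inr 0%N : kappa R)); exists (fun k => inr (k : nat)) => ? ? _ _ [] /val_inj.
Qed.

Lemma small_pure (C : set M) : flat_ML Q M -> card_le_kappa R C ->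
  exists N : submodClosed M,
    [/\ pure N, flat_ML Q (submod N), C `<=` [set` N] & card_le_kappa R [set` N]].
Proof.
move=> FM cC; have [N [clN CN cN]] := solution_closure cC.
have pN : pure N by apply: solution_closed_pure clN; exact: FM.1.
by exists N; split=> //; exact: flat_ML_pure.
Qed.

(** The largest system of submodules that can serve in condition (v). *)
Definition ML_countable (N : submodClosed M) :=
  [/\ countably_presented (submod N), flat_ML Q (submod N)
    & forall A : lmodType R, Q A -> tensor_incl_inj A N].

Lemma ML_countable_union : closed_under_unions (@countable_chain R M) ML_countable.
Proof.
move=> C CU C0 chC; have dC := chain_directed C0 chC.1.
have [N uN] := directed_union dC; exists N; last exact: is_union_set.
split.
- by apply: countably_presented_union C0 chC uN _ => N' /CU[].
- split; first by apply: (flat_union dC uN) => N' /CU[_ []].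
  apply: (ML_union_incl dC uN) => [N' /CU[_ []] //|N' A /CU[_ _ injN]].
  exact: injN.
- by move=> A QA; apply: (tensor_incl_inj_union dC uN) => N' /CU[_ _]; apply.
Qed.

Lemma ML_countable_cover (C : set M) : flat_ML Q M -> Q (R^o : lmodType R) ->
  countable C -> exists2 N, ML_countable N & C `<=` [set` N].
Proof.
move=> FM QR /(countable_enum 0)[c [c_surj _]].
have [n [m [B [mB m_c B_kills]]]] := stable_tower c FM.
have [||N NE] := @submod_from _ M (fun x => exists j, tower_level m j x).
- by exists 0%N, (fun=> 0); rewrite big1 // => k _; rewrite scale0r.
- move=> a x y [i xi] [j yj].
  have [r ->] := tower_level_le mB (leq_maxl i j) xi.
  have [s ->] := tower_level_le mB (leq_maxr i j) yj.
  exists (maxn i j), (fun k => (a : R^c) * (r k : R^c) + s k).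
  rewrite scaler_sumr -big_split; apply: eq_bigr => k _ /=.
  by rewrite scalerA (@scalerDl R^c).
exists N.
  split; first exact: (tower_countably_presented QR mB B_kills NE).
    by split; [exact: (tower_flat QR mB B_kills NE)|exact: (tower_ML mB B_kills NE)].
  by move=> A; apply: (tower_incl_inj mB B_kills NE).
move=> x /c_surj[j <-]; have [k <-] := m_c j; apply/NE.
exists j.+1, (fun l => (l == k)%:R).
rewrite (bigD1 k) //= eqxx scale1r big1 ?addr0 // => l /negPf ->.
by rewrite scale0r.
Qed.

End Conditions.

Theorem proposition2p4 (R : pzRingType) (M : lmodType R^c)
    (Q : lmodType R -> Prop) :
  let cond_i := flat_ML Q M in
  let cond_ii :=
    forall C : set M, card_le_kappa R C ->
      exists N : submodClosed M,
        [/\ pure N, flat_ML Q (submod N), C `<=` [set` N]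
          & card_le_kappa R [set` N]] in
  let cond_iii :=
    exists S : set (submodClosed M),
      [/\ forall N, S N ->
            [/\ pure N, card_le_kappa R [set` N] & flat_ML Q (submod N)],
          forall C : set M, card_le_kappa R C ->
            exists2 N, S N & C `<=` [set` N]
        & closed_under_unions
            (fun C => well_ordered_chain C /\ length_le (kappa R) C) S] in
  let cond_iv :=
    exists T : set (submodClosed M),
      [/\ forall N, T N -> flat_ML Q (submod N),
          directed T,
          \bigcup_(N in T) [set` N] = [set: M]
        & closed_under_unions (@countable_chain R M) T] in
  let cond_v :=
    exists U : set (submodClosed M),
      [/\ forall N, U N ->
            countably_presented (submod N) /\ flat_ML Q (submod N),
          forall N (A : lmodType R), U N -> Q A -> tensor_incl_inj A N,
          forall C : set M, countable C -> exists2 N, U N & C `<=` [set` N]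
        & closed_under_unions (@countable_chain R M) U] in
  [/\ cond_i <-> cond_ii, cond_i <-> cond_iii, cond_i <-> cond_iv,
      cond_v -> cond_i
    & Q (R^o : lmodType R) -> (cond_v <-> cond_i)].

Proof.
move=> cond_i cond_ii cond_iii cond_iv cond_v.
have i_ii : cond_i -> cond_ii by move=> FM C; exact: small_pure.
have ii_i : cond_ii -> cond_i.
  move=> ii; apply: flat_ML_locally => n m.
  have [N [pN FN mN _]] := ii _ (small_range m).
  by exists N; split=> // k; apply: mN; exists k.
have i_iii : cond_i -> cond_iii.
  move=> FM; exists [set N | [/\ pure N, card_le_kappa R [set` N] & flat_ML Q (submod N)]].
  split=> // [C /(small_pure FM)[N [pN FN CN cN]]|C CS C0 [[chC _] lenC]].
    by exists N.
  have [N uN] := directed_union (chain_directed C0 chC).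
  exists N; last exact: is_union_set.
  have pN : pure N by apply: (pure_union (chain_directed C0 chC) uN) => N' /CS[].
  split=> //; last exact: flat_ML_pure.
  by apply: card_chain_union chC lenC uN _ => N' /CS[].
have iii_ii : cond_iii -> cond_ii.
  move=> [S [SP Scov _]] C /Scov[N SN CN]; have [pN cN FN] := SP _ SN.
  by exists N.
have iv_i : cond_iv -> cond_i.
  move=> [T [FT dirT covT clT]]; have [N uN] := directed_union dirT.
  apply: (@flat_ML_top _ _ _ N); last exact: (flat_ML_union dirT uN FT clT).
  move=> x; apply/uN; have : [set: M] x by [].
  by rewrite -covT => -[N' TN' xN']; exists N'.
have i_iv : cond_i -> cond_iv.
  move=> FM; have [//|//|N NT] := @submod_from _ M (fun=> True).
  have {}NT x : x \in N by apply/NT.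
  have pN : pure N.
    apply: solution_closed_pure FM.1 _ => n p m m' B _ mE.
    by exists m' => // l; exact: NT.
  exists [set N]; split.
  - by move=> _ ->; exact: flat_ML_pure.
  - by split; [exists N|move=> _ _ -> ->; exists N; split].
  - by rewrite bigcup_set1; apply/seteqP; split=> x //= _.
  - move=> C CN [N0 CN0] _; exists N => //; apply/seteqP; split=> x /= _; last exact: NT.
    by exists N0; rewrite //= (CN _ CN0); exact: NT.
have v_i : cond_v -> cond_i.
  move=> [U [UP _ Ucov clU]]; apply: iv_i; exists U; split=> //.
  - by move=> N /UP[].
  - by apply: countable_cover_directed => // N /UP[].
  - apply/seteqP; split=> // x _; have [N UN xN] := Ucov _ (countable1 x).
    by exists N => //; apply: xN.
split=> //; [split=> // /iii_ii; exact: ii_i|].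
move=> QR; split=> // FM; exists (@ML_countable R M Q); split.
- by move=> N [].
- by move=> N A [_ _]; apply.
- by move=> C; exact: ML_countable_cover.
- exact: ML_countable_union.
Qed.
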